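(* Let $X=T^*\mathbb{CP}^2$ with its Calabi hyperkähler structure, and let $A=A_{n,0}+(p_0(r)\kappa+p_1(r)\nu_1+p_2(r)\nu_2)\otimes T$ be an $\mathrm{SU}(3)$-invariant connection on the $S^1$-bundle $E_n\to X^*$ in temporal gauge, where $n=2k$ with $k\in\mathbb{Z}$. Let $\widetilde E_k=\Pi^*Q_k\to X$ be the $S^1$-bundle defined in the context. (a) Suppose $A$ is an $I$-$\mathrm{Spin}(7)$-instanton, parametrized as $p_0=-\frac{n}{r^2}\big(1+\frac{C_0}{r^4-1}\big)$, $p_1=C_1(r^4-1)^{1/2}$, $p_2=C_2(r^4-1)^{-3/2}$ with $C_0,C_1,C_2\in\mathbb{R}$. Then $A$ extends to a connection on $\widetilde E_k\to X$ if and only if $C_0=C_2=0$. (b) Suppose $A$ is a $J$-$\mathrm{Spin}(7)$-instanton, parametrized as $p_0=-\frac{n}{r^2}+C_0\frac{1-r^4}{r^2}$, $p_1=C_1(r^4-1)^{-3/2}$, $p_2=C_2(r^4-1)^{-3/2}$ with $C_0,C_1,C_2\in\mathbb{R}$. Then $A$ extends to a connection on $\widetilde E_k\to X$ if and only if $C_1=C_2=0$. (c) Suppose $A$ is a $K$-$\mathrm{Spin}(7)$-instanton, parametrized as $p_0=-\frac{n}{r^2}\big(1+\frac{C_0}{r^4-1}\big)$, $p_1=C_1(r^4-1)^{-3/2}$, $p_2=C_2(r^4-1)^{1/2}$ with $C_0,C_1,C_2\in\mathbb{R}$. Then $A$ extends to a connection on $\widetilde E_k\to X$ if and only if $C_0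=C_1=0$.
   Context: **Calabi structure.** $\mathrm{SU}(3)$ acts on $\mathbb{CP}^2$ in the standard way and hence on $X=T^*\mathbb{CP}^2$; let $X^*=X\setminus\mathbb{CP}^2$ be the complement of the zero section. Let $K_0=\{\mathrm{diag}(e^{i\theta},e^{i\theta},e^{-2i\theta})\}\cong\mathrm{U}(1)$ and $N_{1,1}=\mathrm{SU}(3)/K_0$. Write the left-invariant Maurer–Cartan form of $\mathrm{SU}(3)$ as $$\eta=\begin{bmatrix} i(\zeta+\kappa)&\nu&\sigma\\-\overline\nu&i(\zeta-\kappa)&\mu\\-\overline\sigma&-\overline\mu&-2i\zeta\end{bmatrix},\quad \nu=\nu_1+i\nu_2,\ \sigma=\sigma_1+i\sigma_2,\ \mu=\mu_1+i\mu_2,$$ which defines real left-invariant $1$-forms $\zeta,\kappa,\nu_j,\sigma_j,\mu_j$. The principal locus $X^*$ is identified $\mathrm{SU}(3)$-equivariantly with $(1,\infty)\times N_{1,1}$, with coordinate $r\in(1,\infty)$ and $r\to1$ at the zero section; forms on $X^*$ are identified with their pullbacks to $(1,\infty)\times\mathrm{SU}(3)$. Put $a=\sqrt{(r^2-1)/2}$, $b=\sqrt{(r^2+1)/2}$, $c=r$, $f=\frac1r\sqrt{r^4-1}$, $dt=\sqrt{r^4/(r^4-1)}\,dr$, and $e^0=dt$, $e^1=a\sigma_1$, $e^2=a\sigma_2$, $e^3=b\mu_1$, $e^4=b\mu_2$, $e^5=c\nu_1$, $e^6=c\nu_2$, $e^7=f\kappa$. On $X^*$ the Calabi metric is $g=\sum_{j=0}^7(e^j)^2$,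 with orientation $e^{0}\wedge e^1\wedge\cdots\wedge e^7$ and Kähler forms ($e^{ij}=e^i\wedge e^j$) $$\omega_I=-e^{07}+e^{56}+e^{12}-e^{34},\quad \omega_J=-e^{06}-e^{57}-e^{23}+e^{14},\quad \omega_K=e^{05}-e^{67}+e^{24}+e^{13}.$$ These extend smoothly to a complete $\mathrm{SU}(3)$-invariant hyperkähler structure on $X$. Set $\Phi_I=\frac12(\omega_I^2+\omega_J^2-\omega_K^2)$, $\Phi_J=\frac12(-\omega_I^2+\omega_J^2+\omega_K^2)$, $\Phi_K=\frac12(\omega_I^2-\omega_J^2+\omega_K^2)$. A connection $A$ with curvature $F_A$ is an $L$-$\mathrm{Spin}(7)$-instanton ($L\in\{I,J,K\}$) if $\ast F_A=-\Phi_L\wedge F_A$. The formulas in (a), (b), (c) are the parametrizations of the invariant $L$-$\mathrm{Spin}(7)$-instantons on $E_n$ obtained in the same work. **Bundles and connections.** For $n\in\mathbb{Z}$ let $P_n=(\mathrm{SU}(3)\times S^1)/\!\sim$ with $(h,s)\sim(hz,sz^n)$ for $z\in\mathrm{U}(1)\cong K_0$ (via $e^{i\theta}\mapsto\mathrm{diag}(e^{i\theta},e^{i\theta},e^{-2i\theta})$), a principal $S^1$-bundle over $N_{1,1}$ with left $\mathrm{SU}(3)$-action and right $S^1$-action $[h,s]\cdot s'=[h,s'^{-1}s]$; $E_n=(1,\infty)\times P_n\to X^*$ is its pullback to $X^*$. $T$ is the standard basis vector of $\mathrm{Lie}(S^1)$. A connection on $E_n$ is in temporal gauge if its connection form has no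 $dr$ component; it is identified with its pullback to $(1,\infty)\times\mathrm{SU}(3)$ under $(r,h)\mapsto(r,[h,1])$. The canonical connection is $A_{n,0}=n\zeta\otimes T$. Let $H=\{\mathrm{diag}(A,\det(\overline A)):A\in\mathrm{U}(2)\}\cong\mathrm{U}(2)$, so $\mathbb{CP}^2=\mathrm{SU}(3)/H$, and let $\Pi:T^*\mathbb{CP}^2\to\mathbb{CP}^2$ be the projection. For $k\in\mathbb{Z}$ let $\chi_k:\mathrm{U}(2)\to S^1$, $\chi_k(A)=\det(A)^k$, let $Q_k=(\mathrm{SU}(3)\times S^1)/\!\sim$ with $(h,s)\sim(hA,s\chi_k(A))$ for $A\in\mathrm{U}(2)\cong H$, a homogeneous $S^1$-bundle over $\mathbb{CP}^2$, and set $\widetilde E_k=\Pi^*Q_k\to X$. It is a proved result of the same work that $\widetilde E_k$ is an extension to $X$ of $E_n\to X^*$ if and only if $n=2k$. Extension of a connection across the zero section is understood up to gauge.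
   Formalization: The condition n=2k is replaced by its intended meaning, that Ẽ_k is an SU(3)-equivariant extension of E_n, which with these definitions means n=-k (for n=2k≠0 nothing extends); in (a) and (c) C_0=0 is required only if n≠0, since C_0 drops out of A when n=0. *)

(* Defs.v *)
From HB Require Import structures.
From mathcomp Require Import all_boot all_order all_algebra.
From mathcomp Require Import all_classical all_reals all_analysis.
From mathcomp Require Import complex.

Set Implicit Arguments.
Unset Strict Implicit.
Unset Printing Implicit Defensive.

Import Order.TTheory GRing.Theory Num.Theory numFieldNormedType.Exports.

Local Open Scope classical_set_scope.
Local Open Scope ring_scope.
Local Open Scope complex_scope.

(* C^k on an open set U, by iterated directional derivatives.  For V of
   finite dimension this is the usual notion. *)
Fixpoint Ck (R : realType) (V : normedModType R) (k : nat)
    (U : set V) (f : V -> R) : Prop :=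
  (forall x, U x -> continuous_at x f) /\
  match k with
  | 0 => True
  | k'.+1 => forall v : V,
      (forall x, U x -> derivable f x v) /\ Ck k' U (fun x => 'D_v f x)
  end.

(* The values of f on the submanifold M form a smooth function on M: f is
   smooth on some open neighbourhood of M in the ambient space.  Only the
   restriction of f to M carries information. *)
Definition smooth_near (R : realType) (V : normedModType R)
    (M : set V) (f : V -> R) : Prop :=
  exists U : set V, [/\ open U, M `<=` U & forall k, Ck k U f].

(* Real coordinates on spaces of complex matrices. *)
Definition cplx (R : realType) (m n : nat)
    (p : 'M[R]_(m, n) * 'M[R]_(m, n)) : 'M[R[i]]_(m, n) :=
  \matrix_(i < m, j < n) (p.1 i j +i* p.2 i j).

Definition reim (R : realType) (m n : nat) (A : 'M[R[i]]_(m, n)) :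
    'M[R]_(m, n) * 'M[R]_(m, n) :=
  (map_mx (@complex.Re R) A, map_mx (@complex.Im R) A).

Definition mx3 (R : realType) (s : seq (seq R[i])) : 'M[R[i]]_3 :=
  \matrix_(i < 3, j < 3) nth 0 (nth [::] s i) j.

Definition hadj (R : realType) (m n : nat) (A : 'M[R[i]]_(m, n)) :
    'M[R[i]]_(n, m) := (map_mx Num.conj A)^T.

Definition unitary (R : realType) (m : nat) (A : 'M[R[i]]_m) : Prop :=
  A *m hadj A = 1%:M.

Definition SU3 (R : realType) (h : 'M[R[i]]_3) : Prop :=
  unitary h /\ \det h = 1.

Definition su3 (R : realType) (Y : 'M[R[i]]_3) : Prop :=
  hadj Y = - Y /\ \tr Y = 0.

Definition U1 (R : realType) (z : R[i]) : Prop := `|z| = 1.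

Definition K0 (R : realType) (z : R[i]) : 'M[R[i]]_3 :=
  mx3 [:: [:: z; 0; 0]; [:: 0; z; 0]; [:: 0; 0; z ^- 2]].

(* Components of the Maurer-Cartan form.  All tangent vectors of SU(3) are
   left-trivialised: Y in su(3) stands for h *m Y at h, so eta(Y) = Y. *)
Definition zeta (R : realType) (Y : 'M[R[i]]_3) : R :=
  (complex.Im (Y 0 0) + complex.Im (Y 1 1)) / 2.
Definition kappa (R : realType) (Y : 'M[R[i]]_3) : R :=
  (complex.Im (Y 0 0) - complex.Im (Y 1 1)) / 2.
Definition nu (R : realType) (Y : 'M[R[i]]_3) : R[i] := Y 0 1.
Definition sigma (R : realType) (Y : 'M[R[i]]_3) : R[i] := Y 0 2.
Definition mu (R : realType) (Y : 'M[R[i]]_3) : R[i] := Y 1 2.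

(* A tangent vector (x, Y) of (1,oo) x SU(3) at (r, h) is x d/dr + h Y.
   [coframe r j] is e^j, as a form pulled back to (1,oo) x SU(3). *)
Definition coframe (R : realType) (r : R) (j : 'I_8) (v : R * 'M[R[i]]_3) : R :=
  let a := Num.sqrt ((r ^+ 2 - 1) / 2) in
  let b := Num.sqrt ((r ^+ 2 + 1) / 2) in
  let c := r in
  let f := r^-1 * Num.sqrt (r ^+ 4 - 1) in
  nth 0 [:: Num.sqrt (r ^+ 4 / (r ^+ 4 - 1)) * v.1;
            a * complex.Re (sigma v.2); a * complex.Im (sigma v.2);
            b * complex.Re (mu v.2);    b * complex.Im (mu v.2);
            c * complex.Re (nu v.2);    c * complex.Im (nu v.2);
            f * kappa v.2] j.

(* Exterior algebra on e^0, ..., e^7: w S is the coefficient of the wedge of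
   the e^s, s in S, taken in increasing order. *)
Definition form8 (R : realType) := {ffun {set 'I_8} -> R^o}.

Definition shuffle_sign (R : realType) (S T : {set 'I_8}) : R :=
  (-1) ^+ #|[set p : 'I_8 * 'I_8 |
             [&& p.1 \in S, p.2 \in T & (p.2 < p.1)%N]]%SET|.

Definition wedge (R : realType) (w w' : form8 R) : form8 R :=
  [ffun S : {set 'I_8} => \sum_(T : {set 'I_8} | T \subset S)
     shuffle_sign R T (S :\: T) * w T * w' (S :\: T)].

(* Hodge star: e^0, ..., e^7 is an oriented orthonormal coframe. *)
Definition hodge (R : realType) (w : form8 R) : form8 R :=
  [ffun S : {set 'I_8} => shuffle_sign R (~: S) S * w (~: S)].

(* e^i /\ e^j, for i < j. *)
Definition e2 (R : realType) (i j : 'I_8) : form8 R :=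
  [ffun S : {set 'I_8} => (S == [set i; j]%SET)%:R].

Definition omegaI (R : realType) : form8 R :=
  - e2 R 0 7 + e2 R 5 6 + e2 R 1 2 - e2 R 3 4.
Definition omegaJ (R : realType) : form8 R :=
  - e2 R 0 6 - e2 R 5 7 - e2 R 2 3 + e2 R 1 4.
Definition omegaK (R : realType) : form8 R :=
  e2 R 0 5 - e2 R 6 7 + e2 R 2 4 + e2 R 1 3.

Inductive structure := LI | LJ | LK.

Definition Phi (R : realType) (L : structure) : form8 R :=
  let I2 := wedge (omegaI R) (omegaI R) in
  let J2 := wedge (omegaJ R) (omegaJ R) in
  let K2 := wedge (omegaK R) (omegaK R) in
  match L with
  | LI => 2^-1 *: (I2 + J2 - K2)
  | LJ => 2^-1 *: (- I2 + J2 + K2)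
  | LK => 2^-1 *: (I2 - J2 + K2)
  end.

(* The connection A_{n,0} + (p0 kappa + p1 nu_1 + p2 nu_2) (x) T on E_n,
   pulled back to (1,oo) x SU(3) by (r, h) |-> (r, [h, 1]); it has no dr
   component, so only Y enters. *)
Definition conn (R : realType) (n : int) (p0 p1 p2 : R -> R)
    (r : R) (Y : 'M[R[i]]_3) : R :=
  n%:~R * zeta Y + p0 r * kappa Y
  + p1 r * complex.Re (nu Y) + p2 r * complex.Im (nu Y).

(* F_A = dA (the group is abelian), by the invariant formula
   dA(v, w) = v(A(w)) - w(A(v)) - A([v, w]) on left-invariant fields. *)
Definition curv (R : realType) (n : int) (p0 p1 p2 : R -> R)
    (r : R) (v w : R * 'M[R[i]]_3) : R :=
  v.1 * derive1 (fun s : R => conn n p0 p1 p2 s w.2) r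
  - w.1 * derive1 (fun s : R => conn n p0 p1 p2 s v.2) r
  - conn n p0 p1 p2 r (v.2 *m w.2 - w.2 *m v.2).

Definition spin7_instanton (R : realType) (L : structure) (n : int)
    (p0 p1 p2 : R -> R) : Prop :=
  forall r : R, 1 < r -> exists F : 'I_8 -> 'I_8 -> R,
    (forall v w : R * 'M[R[i]]_3, su3 v.2 -> su3 w.2 ->
       curv n p0 p1 p2 r v w =
       \sum_(i < 8) \sum_(j < 8 | (i < j)%N) F i j *
         (coframe r i v * coframe r j w - coframe r j v * coframe r i w)) /\
    let FA : form8 R :=
      \sum_(i < 8) \sum_(j < 8 | (i < j)%N) (F i j : R) *: e2 R i j in
    hodge FA = - wedge (Phi R L) FA.

(* T^*CP^2 as the homogeneous bundle SU(3) x_H (su(3)/h)^*.  The class of h is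
   the line spanned by h e_3, and the covector given by the row xi takes the
   value Re (xi *m tau) on the tangent vector with Maurer-Cartan part
   tau = (eta_13, eta_23)^T.  Hence
   (h, xi) ~ (h *m embH A, coact xi A)  for A in U(2). *)
Definition embH (R : realType) (A : 'M[R[i]]_2) : 'M[R[i]]_3 :=
  (block_mx A 0 0 ((Num.conj (\det A))%:M : 'M[R[i]]_1) : 'M[R[i]]_(2 + 1)).

Definition coact (R : realType) (xi : 'rV[R[i]]_2) (A : 'M[R[i]]_2) :
    'rV[R[i]]_2 := \det A *: (xi *m A).

Definition lieH (R : realType) (B : 'M[R[i]]_2) : 'M[R[i]]_3 :=
  (block_mx B 0 0 ((Num.conj (\tr B))%:M : 'M[R[i]]_1) : 'M[R[i]]_(2 + 1)).

Definition liecoact (R : realType) (xi : 'rV[R[i]]_2) (B : 'M[R[i]]_2) :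
    'rV[R[i]]_2 := \tr B *: xi + xi *m B.

Definition chi (R : realType) (k : int) (A : 'M[R[i]]_2) : R[i] := (\det A) ^ k.

(* The equivariant identification (1,oo) x N_{1,1} = X^* is
   (r, h K_0) |-> [h *m wmx, rho r *: xi0].
   wmx is needed because K_0 is the centre of H and fixes no nonzero covector
   at the base point: the isotropy of xi0 is the conjugate
   wmx^-1 K_0 wmx = embH {diag(z, z^-2)}.  Under it the tautological form
   pulls back to Re (rho nu), and omega_K - i omega_J = d(rho nu) / 2 fixes
   the radial function rho. *)
Definition wmx (R : realType) : 'M[R[i]]_3 :=
  mx3 [:: [:: 1; 0; 0]; [:: 0; 0; 1]; [:: 0; -1; 0]].

Definition xi0 (R : realType) : 'rV[R[i]]_2 := delta_mx 0 0.

Definition rho (R : realType) (r : R) : R := Num.sqrt (r ^+ 4 - 1).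

Definition isotropy (R : realType) (z : R[i]) : 'M[R[i]]_2 :=
  \matrix_(i < 2, j < 2) (if i == j then (if i == 0 then z else z ^- 2) else 0).

Lemma det_isotropy (R : realType) (z : R[i]) : U1 z ->
  \det (isotropy z) = z^-1.
Proof.
rewrite /U1 => z1.
have z0 : z != 0 by rewrite -normr_eq0 z1 oner_eq0.
have -> : isotropy z = diag_mx (\row_j nth 0 [:: z; z ^- 2] j).
  apply/matrixP => i j; rewrite !mxE.
  by case: i => [[|[|//]] ?]; case: j => [[|[|//]] ?].
rewrite det_diag !big_ord_recl ?big_ord0 !mxE /= ?big_ord0 mulr1.
by rewrite -exprVn expr2 mulrA divff // mul1r.
Qed.

Lemma K0_wmx (R : realType) (z : R[i]) : U1 z ->
  K0 z *m wmx R = wmx R *m embH (isotropy z) /\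
  coact (xi0 R) (isotropy z) = xi0 R.
Proof.
rewrite /U1 => z1.
have z0 : z != 0 by rewrite -normr_eq0 z1 oner_eq0.
have zz : z^-1 = Num.conj z by rewrite invC_norm z1 expr1n invr1 mul1r.
have dI := det_isotropy z1.
split.
  have E i j : embH (isotropy z) i j =
      mx3 [:: [:: z; 0; 0]; [:: 0; z ^- 2; 0]; [:: 0; 0; z]] i j.
    have cz : Num.conj z^-1 = z by rewrite zz conjCK.
    rewrite /embH dI cz /mx3.
    case: i => [[|[|[|//]]] ?]; case: j => [[|[|[|//]]] ?]; rewrite !mxE /=;
      case: splitP => -[[|[|//]] ?] //= ?; rewrite !mxE /=;
      case: splitP => -[[|[|//]] ?] //= ?; rewrite !mxE //=.
  apply/matrixP => i j; rewrite !mxE !big_ord_recl ?big_ord0 !E.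
  case: i => [[|[|[|//]]] ?]; case: j => [[|[|[|//]]] ?];
    by rewrite ?mxE /= ?big_ord0 ?(mulr0, mul0r, mulr1, mul1r, addr0, add0r, mulrN1, mulN1r).
apply/matrixP => i j; rewrite /coact dI !mxE !big_ord_recl ?big_ord0 !mxE.
case: i => [[|//] ?]; case: j => [[|[|//]] ?];
  rewrite /= ?big_ord0 ?mxE /= ?(mulr0, mul0r, addr0, mul1r) ?mulVf //.
Qed.

(* A connection on Et_k = Pi^* Q_k, as its pullback alpha to SU(3) x C^2 under
   (h, xi) |-> [h, xi, 1].  [alpha h xi Y tau] is its value on the tangent
   vector (h *m Y, tau) at (h, xi).  The last two conditions say that alpha
   comes from a connection on the quotient by H; in the last one,
   k Im (tr B) is the differential of chi k. *)
Definition connection_on_Et (R : realType) (k : int)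
    (alpha : 'M[R[i]]_3 -> 'rV[R[i]]_2 -> 'M[R[i]]_3 -> 'rV[R[i]]_2 -> R) : Prop :=
  [/\ forall h xi, SU3 h ->
        forall (a : R) Y Z tau ups, su3 Y -> su3 Z ->
        alpha h xi (a%:C *: Y + Z) (a%:C *: tau + ups) =
        a * alpha h xi Y tau + alpha h xi Z ups,
      forall Y tau, su3 Y ->
        smooth_near
          [set p : ('M[R]_3 * 'M[R]_3) * ('rV[R]_2 * 'rV[R]_2) | SU3 (cplx p.1)]
          (fun p => alpha (cplx p.1) (cplx p.2) Y tau),
      forall A h xi Y tau, unitary A -> SU3 h -> su3 Y ->
        alpha (h *m embH A) (coact xi A)
              (invmx (embH A) *m Y *m embH A) (coact tau A) =
        alpha h xi Y tau
    & forall B h xi, hadj B = - B -> SU3 h ->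
        alpha h xi (lieH B) (liecoact xi B) = k%:~R * complex.Im (\tr B)].

Definition ucoord (R : realType) (c : R[i] -> R) (u : R -> 'M[R[i]]_3 -> R[i])
    (p : R * ('M[R]_3 * 'M[R]_3)) : R := c (u p.1 (cplx p.2)).

(* An isomorphism E_n -> Et_k restricted to X^*, covering the identity of X^*:
   (r, [h, 1]) |-> [h *m wmx, rho r *: xi0, u r h].  The last condition
   expresses that it is well defined, by (h, s) ~ (hz, s z^n) in P_n and
   (h, s) ~ (hA, s chi_k A) in Q_k. *)
Definition bundle_iso (R : realType) (n k : int)
    (u : R -> 'M[R[i]]_3 -> R[i]) : Prop :=
  let M := [set p : R * ('M[R]_3 * 'M[R]_3) | 1 < p.1 /\ SU3 (cplx p.2)] in
  [/\ forall r h, 1 < r -> SU3 h -> U1 (u r h),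
      smooth_near M (ucoord (@complex.Re R) u),
      smooth_near M (ucoord (@complex.Im R) u)
    & forall r h z, 1 < r -> SU3 h -> U1 z ->
        u r (h *m K0 z) = u r h * z ^ (- n) * chi k (isotropy z)].

(* Et_k is an extension of E_n as an SU(3)-homogeneous bundle. *)
Definition bundle_extends (R : realType) (n k : int) : Prop :=
  exists u : R -> 'M[R[i]]_3 -> R[i], bundle_iso n k u /\
    forall r g h, 1 < r -> SU3 g -> SU3 h -> u r (g *m h) = u r h.

Lemma smooth_near_cst (R : realType) (V : normedModType R) (M : set V) (c : R) :
  smooth_near M (fun=> c).
Proof.
exists setT; split => [|//|k]; first exact: openT.
elim: k c => [|k IH] c /=; (split; first by move=> x _; exact: cvg_cst) => // v.
split => [x _|]; first exact: derivable_cst.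
suff -> : (fun x => 'D_v (fun=> c) x) = (fun=> 0 : R) :> (V -> R) by exact: IH.
by apply/funext => x; exact: derive_cst.
Qed.

Lemma SU3_K0 (R : realType) (z : R[i]) : U1 z -> SU3 (K0 z).
Proof.
rewrite /U1 => z1.
have z0 : z != 0 by rewrite -normr_eq0 z1 oner_eq0.
have zz : Num.conj z = z^-1 by rewrite invC_norm z1 expr1n invr1 mul1r.
have dK : K0 z = diag_mx (\row_j nth 0 [:: z; z; z ^- 2] j).
  apply/matrixP => i j; rewrite !mxE.
  by case: i => [[|[|[|//]]] ?]; case: j => [[|[|[|//]]] ?].
split; last first.
  rewrite dK det_diag !big_ord_recl ?big_ord0 !mxE /= ?big_ord0 mulr1 mulrA.
  by rewrite -expr2 mulfV // expf_neq0.
apply/matrixP => i j; rewrite !mxE !big_ord_recl ?big_ord0 !mxE.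
case: i => [[|[|[|//]]] ?]; case: j => [[|[|[|//]]] ?];
  rewrite /= ?big_ord0 ?rmorph0 ?(mulr0, mul0r, addr0, add0r) //.
- by rewrite zz mulfV.
- by rewrite zz mulfV.
- by rewrite rmorphV ?unitfE ?expf_neq0 // rmorphXn /= zz exprVn invrK mulVf // expf_neq0.
Qed.

(* The character chi k restricted to the isotropy diag(z, z^-2) of xi0 is
   z |-> z^(-k).  (The value z^(2k) would be its restriction to K_0 as the
   centre of H, but H / K_0 = SO(3) is not the sphere of cotangent directions;
   the forms collapsing at r = 1 are sigma_1, sigma_2, kappa.) *)
Lemma bundle_extendsP (R : realType) (n k : int) :
  bundle_extends R n k <-> n = - k.
Proof.
have chiE (z : R[i]) : U1 z -> chi k (isotropy z) = z ^ (- k).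
  by move=> z1; rewrite /chi det_isotropy // exprz_inv.
have SU31 : SU3 (1%:M : 'M[R[i]]_3).
  by split; rewrite ?det1 // /unitary /hadj map_scalar_mx /= tr_scalar_mx conjC1 mulmx1.
split; last first.
  move=> ->; exists (fun _ _ => 1); split => //; split.
  - by move=> *; rewrite /U1 normr1.
  - exact: smooth_near_cst.
  - exact: smooth_near_cst.
  - move=> r h z _ _ z1; rewrite chiE // mul1r opprK -expfzDr ?subrr //.
    by rewrite -normr_eq0 z1 oner_eq0.
case=> u [[u1 _ _ ul] ui].
have r2 : 1 < 2 :> R by rewrite ltr1n.
have H (z : R[i]) : U1 z -> z ^ (- n - k) = 1.
  move=> z1; have z0 : z != 0 by rewrite -normr_eq0 z1 oner_eq0.
  have := ul 2 1%:M z r2 SU31 z1.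
  rewrite mul1mx -[K0 z]mulmx1 (ui 2 _ _ r2 (SU3_K0 z1) SU31) chiE //.
  rewrite -mulrA -expfzDr // => /esym e.
  have uu : u 2 1%:M != 0 by rewrite -normr_eq0 (u1 _ _ r2 SU31) oner_eq0.
  by apply: (mulfI uu); rewrite e mulr1.
apply/eqP; rewrite -subr_eq0 opprK; apply: contraT => nk.
set m := absz (n + k); have m0 : (0 < m)%N by rewrite absz_gt0.
have zm : (m.-root (-1 : R[i])) ^+ m = -1 by rewrite rootCK.
have z1 : U1 (m.-root (-1 : R[i])).
  apply/eqP; rewrite -(@pexpr_eq1 _ _ m) //.
  by rewrite -normrX zm normrN1.
have := H _ z1; rewrite -opprD -invr_expz => /(congr1 GRing.inv).
rewrite invrK invr1.
have [-> | ->] : n + k = m%:Z \/ n + k = - m%:Z.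
  by rewrite /m; case: (n + k) => p; [left | right; rewrite NegzE].
- by rewrite -exprnP zm => /eqP; rewrite eqNr oner_eq0.
- by rewrite -invr_expz -exprnP zm invrN invr1 => /eqP; rewrite eqNr oner_eq0.
Qed.

(* The 1-form d(arg u) on (1,oo) x SU(3), at (r, h) on x d/dr + h Y. *)
Definition darg (R : realType) (u : R -> 'M[R[i]]_3 -> R[i])
    (r : R) (h : 'M[R[i]]_3) (x : R) (Y : 'M[R[i]]_3) : R :=
  let v : R * ('M[R]_3 * 'M[R]_3) := (x, reim (h *m Y)) in
  let p : R * ('M[R]_3 * 'M[R]_3) := (r, reim h) in
  complex.Re (u r h) * 'D_v (ucoord (@complex.Im R) u) p
  - complex.Im (u r h) * 'D_v (ucoord (@complex.Re R) u) p.

(* A is the pullback of a smooth connection on Et_k -> X by some bundle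
   isomorphism over X^* ("extension up to gauge"); u need not be invariant.
   The minus sign: s' acts on [h, s] as s'^-1. *)
Definition extends_to_Et (R : realType) (n k : int) (p0 p1 p2 : R -> R) : Prop :=
  exists alpha u, [/\ connection_on_Et k alpha, @bundle_iso R n k u
    & forall r h x Y, 1 < r -> SU3 h -> su3 Y ->
        conn n p0 p1 p2 r Y =
        alpha (h *m wmx R) ((rho r)%:C *: xi0 R)
              (invmx (wmx R) *m Y *m wmx R)
              ((x * derive1 (@rho R) r)%:C *: xi0 R)
        - darg u r h x Y].

(* Main.v *)
Require Import Defs.
From mathcomp Require Import all_boot all_order all_algebra.
From mathcomp Require Import all_classical all_reals all_analysis.
From mathcomp Require Import complex ring lra.
Import Order.TTheory GRing.Theory Num.Theory numFieldNormedType.Exports.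
Local Open Scope classical_set_scope.
Local Open Scope complex_scope.
Local Open Scope ring_scope.

(* Since n = -k, the homogeneous connection k Im tr B of the extension pulls back
   to n (zeta - kappa).  The 1-forms Im <D xi, xi>, Re and Im of the
   tautological form are smooth on T^*CP^2 and pull back to -2 rho^2 kappa,
   rho nu_1 and rho nu_2 with rho = |xi| = (r^4 - 1)^(1/2); smooth functions of
   rho^2 times these give the connections that extend.

   Conversely, let exp(tY) be a circle in SU(2) and c(r) = A(Y).  If A is
   alpha - d(arg u), then for r' close to r the two loops t |-> u(r, exp(tY))
   and t |-> u(r', exp(tY)) in the circle are uniformly close, so by Rolle's
   theorem they have the same speed at some t; there c(r) - c(r') is a
   difference of values of alpha, bounded by L |rho(r) - rho(r')| with L
   uniform up to the zero section.  Hence c is locally Lipschitz in rho with a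
   uniform constant, which excludes the poles rho^(-2) and rho^(-3). *)

(** * Directional derivatives along curves *)

(** On the line [h *: v + x] a directional derivative becomes a one-variable derivative, so the
    one-variable chain rule applies; of [f] only the derivative along [v] is assumed. *)
Lemma is_derive_comp1 {R : realType} {V : normedModType R} (f : V -> R)
    (g : R -> R) (x v : V) (df dg : R) :
  is_derive x v f df -> is_derive (f x) 1 g dg ->
  is_derive x v (g \o f) (dg * df).
Proof.
have line (p : V -> R) : (fun h : R => h^-1 *:
    (((fun s : R => p (s *: v + x)) \o shift 0) (h *: 1)
     - p ((0 : R) *: v + x))) =
    (fun h : R => h^-1 *: ((p \o shift x) (h *: v) - p x)).
  by apply/funext => h /=; rewrite addr0 scale0r add0r [_%:A]mulr1.
move=> [fd fE] gd.
have fl : is_derive (0 : R) (1 : R) (fun h : R => f (h *: v + x)) df.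
  by split; rewrite /derivable /derive line.
have gd' : is_derive (f ((0 : R) *: v + x)) 1 g dg by rewrite scale0r add0r.
have [cd cE] := @is_derive1_comp _ _ _ _ _ _ gd' fl.
by split; [move: cd | rewrite -cE];
  rewrite /derivable /derive (line (g \o f)).
Qed.

Lemma is_derive_line {R : realType} {V : normedModType R} (f : V -> R)
    (x v : V) (s : R) :
  derivable f (x + s *: v) v ->
  is_derive s (1 : R) (fun s : R => f (x + s *: v)) ('D_v f (x + s *: v)).
Proof.
move=> fd.
have E : (fun h : R => h^-1 *: (((fun s : R => f (x + s *: v)) \o shift s)
    (h *: 1) - f (x + s *: v))) =
    (fun h : R => h^-1 *: ((f \o shift (x + s *: v)) (h *: v) - f (x + s *: v))).
  apply/funext => h /=; congr (_ *: (f _ - _)).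
  by rewrite [_%:A]mulr1 scalerDl addrCA.
by split; [rewrite /derivable E | rewrite /derive E].
Qed.

(** Mean value theorem. With [A] the derivative at a base point it controls a first-order remainder;
    with [A = 0] it is a Lipschitz bound. *)
Lemma increment_bound {R : realType} {V : normedModType R} (f : V -> R)
    (x v : V) (A e : R) (s0 s1 : R) :
  (forall s, s \in `[Num.min s0 s1, Num.max s0 s1] ->
     derivable f (x + s *: v) v /\ `|'D_v f (x + s *: v) - A| <= e) ->
  `|f (x + s1 *: v) - f (x + s0 *: v) - A * (s1 - s0)| <= e * `|s1 - s0|.
Proof.
wlog s01 : s0 s1 / s0 <= s1.
  move=> H; have /orP[/H|s10 h] := le_total s0 s1; first exact.
  rewrite [X in _ <= _ * X]distrC -[X in X <= _]normrN.
  have -> : - (f (x + s1 *: v) - f (x + s0 *: v) - A * (s1 - s0)) =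
    f (x + s0 *: v) - f (x + s1 *: v) - A * (s0 - s1) by ring.
  by apply: (H _ _ s10) => s; rewrite minC maxC; exact: h.
rewrite min_l // max_r // => h.
have d s : s \in `[s0, s1] ->
    is_derive s (1 : R) (fun s : R => f (x + s *: v)) ('D_v f (x + s *: v)).
  by move=> /h [? _]; exact: is_derive_line.
have d' s : s \in `]s0, s1[ ->
    is_derive s (1 : R) (fun s : R => f (x + s *: v)) ('D_v f (x + s *: v)).
  by move=> /subset_itv_oo_cc /d.
have ct : {within `[s0, s1], continuous (fun s : R => f (x + s *: v))}.
  by apply: derivable_within_continuous => s /d [].
have [c /h [_ hc] ->] := MVT_segment s01 d' ct.
by rewrite -mulrBl normrM ler_wpM2r.
Qed.

(** [Ck] speaks of directional derivatives, not of a Fréchet derivative. For a curve in the affine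
    plane through [S] with directions [P] and [Q] the classical argument for C^1 functions of two
    variables works: split the increment into a step along [P] and a step along [Q], and treat each
    by the mean value theorem. *)
Lemma is_derive_curve {R : realType} {V : normedModType R} (U : set V)
    (f : V -> R) (P Q S : V) (a b : R -> R) (t a' b' : R) :
  open U ->
  (forall v x, U x -> derivable f x v) ->
  (forall v x, U x -> {for x, continuous (fun x => 'D_v f x)}) ->
  U (a t *: P + b t *: Q + S) ->
  is_derive t (1 : R) a a' -> is_derive t (1 : R) b b' ->
  is_derive t (1 : R) (fun t => f (a t *: P + b t *: Q + S))
    (a' * 'D_P f (a t *: P + b t *: Q + S)
     + b' * 'D_Q f (a t *: P + b t *: Q + S)).
Proof.
move=> oU fd fc Ut [ad aE] [bd bE].
set x0 := _ + S; set A := 'D_P f x0; set B := 'D_Q f x0.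
pose G (p : R * R) : V := p.1 *: P + p.2 *: Q + S.
have Gc : continuous G.
  move=> p; apply: cvgD; last exact: cvg_cst.
  by apply: cvgD; apply: cvgZr_tmp; [exact: cvg_fst | exact: cvg_snd].
pose q (c : R -> R) (h : R) := h^-1 * (c (h + t) - c t).
have aq : q a h @[h --> 0^'] --> a'.
  rewrite -aE; move: ad => /cvgP; rewrite /derive /q.
  under eq_fun do rewrite /= [_%:A]mulr1.
  by [].
have bq : q b h @[h --> 0^'] --> b'.
  rewrite -bE; move: bd => /cvgP; rewrite /derive /q.
  under eq_fun do rewrite /= [_%:A]mulr1.
  by [].
pose F h := f (G (a h, b h)).
suff Fq : q F h @[h --> 0^'] --> a' * A + b' * B.
  have E : (fun h : R => h^-1 *: ((F \o shift t) (h *: 1) - F t)) = q F.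
    by apply/funext => h; rewrite /q /= [_%:A]mulr1.
  split; first by rewrite /derivable E; apply/cvg_ex; eexists; exact: Fq.
  by rewrite /derive E; exact: cvg_lim Fq.
have shc (c : R -> R) : derivable c t 1 -> c (h + t) @[h --> 0^'] --> c t.
  move=> /derivable1_diffP/differentiable_continuous cc.
  have sc : h + t @[h --> (0 : R)] --> t.
    rewrite -[X in _ --> X](add0r t).
    by apply: cvgD; [exact: cvg_id | exact: cvg_cst].
  by apply: cvg_within_filter; exact: (cvg_comp _ _ sc cc).
(* The first-order remainder divided by [h]. The bracket on the right has a finite limit, so this
   bound makes the remainder tend to 0. *)
have key e : 0 < e -> \forall h \near 0^',
    `|q F h - (q a h * A + q b h * B)| <= e * (`|q a h| + `|q b h|).
  move=> e0.
  have good : \forall x \near x0,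
      U x /\ (`|'D_P f x - A| <= e /\ `|'D_Q f x - B| <= e).
    near=> x; split; first by near: x; exact: open_nbhs_nbhs.
    split; near: x; [move: (fc P x0 Ut) | move: (fc Q x0 Ut)].
      by move=> /cvgrPdist_le /(_ _ e0); under eq_near do rewrite distrC.
    by move=> /cvgrPdist_le /(_ _ e0); under eq_near do rewrite distrC.
  have : \forall p \near (a t, b t), U (G p) /\
      (`|'D_P f (G p) - A| <= e /\ `|'D_Q f (G p) - B| <= e).
    exact: (Gc (a t, b t)) good.
  case/nbhs_ballP => d /= d0 db.
  have ha : \forall h \near 0^', `|a (h + t) - a t| < d.
    by move/cvgrPdist_lt: (shc _ ad) => /(_ _ d0); under eq_near do rewrite distrC.
  have hb : \forall h \near 0^', `|b (h + t) - b t| < d.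
    by move/cvgrPdist_lt: (shc _ bd) => /(_ _ d0); under eq_near do rewrite distrC.
  near=> h.
  have hda : `|a (h + t) - a t| < d by near: h.
  have hdb : `|b (h + t) - b t| < d by near: h.
  (* Points between the old and the new value stay within [d] of the old one, so both steps remain
     where the derivatives are [e]-close to [A] and [B]. *)
  have btw (y z s : R) : `|z - y| < d -> s \in `[Num.min y z, Num.max y z] ->
      `|y - s| < d.
    rewrite in_itv /=; case: (leP y z) => yz; rewrite !ltr_norml;
      by move=> /andP[? ?] /andP[? ?]; apply/andP; split; lra.
  (* The step along [P] is taken at the new value of [b], the step along [Q] in [h2] at the old
     value of [a]; together they telescope. *)
  have h1 : `|f (G (a (h + t), b (h + t))) - f (G (a t, b (h + t)))
      - A * (a (h + t) - a t)| <= e * `|a (h + t) - a t|.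
    have GE s : G (s, b (h + t)) = b (h + t) *: Q + S + s *: P.
      by rewrite /G /= -addrA addrC.
    rewrite !GE; apply: increment_bound => s sab; rewrite -GE.
    have [? [? _]] := db (s, b (h + t)) (conj (btw _ _ _ hda sab)
      (eq_ind _ (fun y => y < d) hdb _ (distrC _ _))).
    by split; [exact: fd | assumption].
  have h2 : `|f (G (a t, b (h + t))) - f (G (a t, b t))
      - B * (b (h + t) - b t)| <= e * `|b (h + t) - b t|.
    have GE s : G (a t, s) = a t *: P + S + s *: Q by rewrite /G /= addrAC.
    rewrite !GE; apply: increment_bound => s sab; rewrite -GE.
    have aa : ball (a t) d (a t) by exact: ballxx.
    have [? [_ ?]] := db (a t, s) (conj aa (btw _ _ _ hdb sab)).
    by split; [exact: fd | assumption].
  have -> : q F h - (q a h * A + q b h * B) = h^-1 *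
    ((f (G (a (h + t), b (h + t))) - f (G (a t, b (h + t)))
      - A * (a (h + t) - a t)) + (f (G (a t, b (h + t))) - f (G (a t, b t))
      - B * (b (h + t) - b t))) by rewrite /q /F; ring.
  have -> : e * (`|q a h| + `|q b h|) =
      `|h^-1| * (e * `|a (h + t) - a t| + e * `|b (h + t) - b t|).
    by rewrite /q !normrM; ring.
  rewrite normrM; apply: ler_wpM2l; first exact: normr_ge0.
  by apply: (le_trans (ler_normD _ _)); exact: lerD h1 h2.
have lin : (q a h * A + q b h * B) @[h --> 0^'] --> a' * A + b' * B.
  by apply: cvgD; (apply: cvgM; [assumption | exact: cvg_cst]).
have nrm : (`|q a h| + `|q b h|) @[h --> 0^'] --> `|a'| + `|b'|.
  by apply: cvgD; [exact: (cvg_norm aq) | exact: (cvg_norm bq)].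
suff dif : (q F h - (q a h * A + q b h * B)) @[h --> 0^'] --> (0 : R).
  rewrite -[X in _ --> X]add0r.
  under eq_fun => h do rewrite -[q F h](subrK (q a h * A + q b h * B)).
  exact: cvgD.
apply: (cvgr0Pnorm_le _).2 => e e0.
set K := `|a'| + `|b'| + 1.
have K0 : 0 < K by rewrite ltr_wpDl // addr_ge0.
have eK : 0 < e / K by rewrite divr_gt0.
near=> h; apply: (@le_trans _ _ (e / K * (`|q a h| + `|q b h|))).
  by near: h; exact: (key _ eK).
rewrite -[leRHS](divfK (lt0r_neq0 K0)) ler_wpM2l ?ltW //.
by near: h; apply: (cvgr_lt _ nrm); rewrite /K ltrDl ltr01.
Unshelve. all: by end_near. Qed.

(** The chain rule just proved, applied at 0 to the straight line with direction
    [a *: P + b *: Q]. *)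
Lemma derive_lin_comb {R : realType} {V : normedModType R} (U : set V)
    (f : V -> R) (P Q x : V) (a b : R) :
  open U ->
  (forall v x, U x -> derivable f x v) ->
  (forall v x, U x -> {for x, continuous (fun x => 'D_v f x)}) ->
  U x -> 'D_(a *: P + b *: Q) f x = a * 'D_P f x + b * 'D_Q f x.
Proof.
move=> oU fd fc Ux.
have lin (c : R) : is_derive (0 : R) (1 : R) (fun s => s * c) c.
  have -> : (fun s => s * c) = id * cst c by [].
  by apply: is_derive_eq; rewrite fctE /GRing.scale /= mulr0 add0r mulr1.
have x0 : (0 * a) *: P + (0 * b) *: Q + x = x by rewrite !mul0r !scale0r !add0r.
have Ux0 : U ((0 * a) *: P + (0 * b) *: Q + x) by rewrite x0.
have [_] := is_derive_curve U f P Q x (fun s => s * a) (fun s => s * b)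
  0 a b oU fd fc Ux0 (lin a) (lin b).
rewrite x0 => <-; apply/esym.
have dx : derivable f (x + 0 *: (a *: P + b *: Q)) (a *: P + b *: Q).
  by rewrite scale0r addr0; exact: fd.
have [_] := is_derive_line f x (a *: P + b *: Q) 0 dx.
have -> : (fun s => f (x + s *: (a *: P + b *: Q))) =
    (fun s => f ((s * a) *: P + (s * b) *: Q + x)).
  by apply/funext => s; rewrite scalerDr !scalerA addrC.
by rewrite scale0r addr0.
Qed.

(** * Uniformity over compact intervals, and loops in the unit circle *)

(** Tube lemma: a neighbourhood of the slice over the compact interval contains a product
    neighbourhood. It will keep two loops close for all parameters at once. *)
Lemma near_segment {R : realType} (h : R * R -> R) (r T : R) :
  (forall t, {for (r, t), continuous h}) -> (forall t, 0 < h (r, t)) ->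
  \forall r' \near r, forall t, t \in `[0, T] -> 0 < h (r', t).
Proof.
move=> hc h0; have cT := @segment_compact R 0 T.
have /compact_near_coveringP := cT.
move=> /(_ R (nbhs r) (fun r' t => 0 < h (r', t)) _).
move=> H; apply: filterS (H _) => [r' sub t tT|t _]; first exact: sub.
have := cvgr_gt _ (hc t) _ (h0 t).
(* The covering property lists the point of the interval before the parameter, hence the exchanged
   pair. *)
case=> [[A B] /= [Ar Bt] AB]; exists (B, A) => //= -[t' r'] /= [Bt' Ar'].
exact: (AB (r', t')).
Qed.

Lemma bounded_on_rectangle {R : realType} (h : R * R -> R) (T S : R) :
  continuous h ->
  exists L : R, forall t s, t \in `[0, T] -> s \in `[0, S] -> `|h (t, s)| <= L.
Proof.
move=> hc.
have cK := compact_setX (@segment_compact R 0 T) (@segment_compact R 0 S).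
have /compact_bounded[M [_ HM]] : compact (h @` (`[0, T]%classic `*` `[0, S]%classic)).
  by apply: continuous_compact => //; exact: continuous_subspaceT.
exists (M + 1) => t s tT sS; apply: (HM (M + 1)); first by rewrite ltrDl ltr01.
by exists (t, s).
Qed.

(** The last hypothesis keeps the quotient of the two loops in the right half-plane, where the
    argument is single-valued. So the difference of the two arguments is a genuine function with
    equal end values, even when each loop winds around the circle; [a b' - b a'] is the derivative
    of the argument. *)
Lemma loops_same_speed {R : realType} (a b c d a' b' c' d' : R -> R) (T : R) :
  0 < T ->
  (forall t, is_derive t (1 : R) a (a' t)) ->
  (forall t, is_derive t (1 : R) b (b' t)) ->
  (forall t, is_derive t (1 : R) c (c' t)) ->
  (forall t, is_derive t (1 : R) d (d' t)) ->
  (forall t, a t ^+ 2 + b t ^+ 2 = 1) -> (forall t, c t ^+ 2 + d t ^+ 2 = 1) ->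
  a 0 = a T -> b 0 = b T -> c 0 = c T -> d 0 = d T ->
  (forall t, t \in `[0, T] -> 0 < a t * c t + b t * d t) ->
  exists2 t, t \in `[0, T] &
    a t * b' t - b t * a' t = c t * d' t - d t * c' t.
Proof.
move=> T0 da db dc dd ab1 cd1 a0 b0 c0 d0 pos.
(* q / p is the tangent of the argument of (a + ib)(c - id); apply Rolle to it. *)
pose p := a * c + b * d; pose q := b * c - a * d.
have dp t : is_derive t (1 : R) p
  (a t *: c' t + c t *: a' t + (b t *: d' t + d t *: b' t)).
  by apply: is_deriveD; apply: is_deriveM.
have dq t : is_derive t (1 : R) q
  (b t *: c' t + c t *: b' t - (a t *: d' t + d t *: a' t)).
  by apply: is_deriveB; apply: is_deriveM.
have p0 t : t \in `[0, T] -> p t != 0 by move=> /pos /lt0r_neq0.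
pose f := q * (fun t => (p t)^-1).
have df t : t \in `[0, T] -> is_derive t (1 : R) f
    (q t *: (- (p t) ^- 2 *: (a t *: c' t + c t *: a' t + (b t *: d' t + d t *: b' t)))
     + (p t)^-1 *: (b t *: c' t + c t *: b' t - (a t *: d' t + d t *: a' t))).
  move=> tT; apply: is_deriveM.
  have [pd pE] := dp t.
  by split; [exact: derivableV (p0 _ tT) pd | rewrite -pE; exact: deriveV (p0 _ tT) pd].
have fdr t : t \in `]0, T[ -> derivable f t 1.
  by move=> /subset_itv_oo_cc /df [].
have fc : {within `[0, T], continuous f}.
  by apply: derivable_within_continuous => t /df [].
have f0T : f 0 = f T by rewrite /f /q /p !fctE a0 b0 c0 d0.
have [t tT [_ fE]] := Rolle T0 fdr fc f0T.
have {}tT : t \in `[0, T] by exact: subset_itv_oo_cc.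
exists t => //; have [_] := df t tT; rewrite fE.
have := p0 t tT; have := ab1 t; have := cd1 t; rewrite /q /p !fctE /GRing.scale /=.
move: (a t) (b t) (c t) (d t) (a' t) (b' t) (c' t) (d' t).
move=> A B C D A' B' C' D' cd ab p0' /eqP.
rewrite eq_sym => /eqP E.
have : (A * C + B * D) * (B * C' + C * B' - (A * D' + D * A'))
  - (B * C - A * D) * (A * C' + C * A' + (B * D' + D * B')) = 0.
  by rewrite -[RHS](mulr0 ((A * C + B * D) ^+ 2)) -E; field.
(* The numerator of the derivative is the difference of the two speeds, each weighted by the squared
   modulus of the other loop, which is 1. *)
have -> : (A * C + B * D) * (B * C' + C * B' - (A * D' + D * A'))
  - (B * C - A * D) * (A * C' + C * A' + (B * D' + D * B')) =
  (A * B' - B * A') * (C ^+ 2 + D ^+ 2) - (C * D' - D * C') * (A ^+ 2 + B ^+ 2).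
  by ring.
by rewrite ab cd !mulr1 => /eqP; rewrite subr_eq0 => /eqP.
Qed.

(** * Circles in SU(2) *)

Lemma cplx_reim {R : realType} {m n : nat} (A : 'M[R[i]]_(m, n)) :
  cplx (reim A) = A.
Proof. by apply/matrixP => i j; rewrite !mxE; case: (A i j). Qed.

Lemma reimD {R : realType} {m n : nat} (A B : 'M[R[i]]_(m, n)) :
  reim (A + B) = reim A + reim B.
Proof.
by congr pair; apply/matrixP => i j; rewrite !mxE; case: (A i j); case: (B i j).
Qed.

Lemma reimZ {R : realType} {m n : nat} (a : R) (A : 'M[R[i]]_(m, n)) :
  reim (a%:C *: A) = a *: reim A.
Proof.
congr pair; apply/matrixP => i j; rewrite !mxE; case: (A i j) => x y /=;
  by rewrite mul0r ?subr0 ?addr0.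
Qed.

(** The upper left block is a quaternion with real part [a]: unit quaternions give SU(2), imaginary
    ones its Lie algebra. At [a = 0] one has [zeta = 0], [kappa = b] and [nu = x +i* y], so the
    connection takes the value [p0 b + p1 x + p2 y]. *)
Definition su2mx {R : realType} (a b x y : R) : 'M[R[i]]_3 :=
  mx3 [:: [:: a +i* b; x +i* y; 0];
          [:: (- x) +i* y; a -i* b; 0]; [:: 0; 0; 0]].

Definition e33 {R : realType} : 'M[R[i]]_3 :=
  mx3 [:: [:: 0; 0; 0]; [:: 0; 0; 0]; [:: 0; 0; 1]].

Ltac mx3_entries :=
  let i := fresh "i" in let j := fresh "j" in
  apply/matrixP => i j;
  case: i => [[|[|[|//]]] ?]; case: j => [[|[|[|//]]] ?];
  rewrite ?mxE ?big_ord_recl ?big_ord0 ?mxE /=.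

Ltac complex_eq := apply/eqP; rewrite eq_complex /=; apply/andP; split; apply/eqP.

Lemma det_mx33 {K : comNzRingType} (A : 'M[K]_3) :
  \det A = A 0 0 * (A 1 1 * A 2 2 - A 1 2 * A 2 1)
         - A 0 1 * (A 1 0 * A 2 2 - A 1 2 * A 2 0)
         + A 0 2 * (A 1 0 * A 2 1 - A 1 1 * A 2 0).
Proof.
rewrite (expand_det_row _ 0) !big_ord_recl big_ord0 /cofactor.
rewrite !(expand_det_row _ 0) !big_ord_recl !big_ord0 /cofactor !det_mx11 !mxE.
do ![rewrite [lift _ _](_ : _ = 0); last exact: val_inj
    |rewrite [lift _ _](_ : _ = 1); last exact: val_inj
    |rewrite [lift _ _](_ : _ = 2); last exact: val_inj].
rewrite /= /bump /= ?addn0 ?expr0 ?expr1 ?exprS ?expr0.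
by ring.
Qed.

Lemma wmx_unitary {R : realType} : (wmx R)^T *m wmx R = 1%:M.
Proof.
mx3_entries; rewrite ?mxE /=; complex_eq; ring.
Qed.

Lemma invmx_wmx {R : realType} : invmx (wmx R) = (wmx R)^T.
Proof.
have [u _] := mulmx1_unit (@wmx_unitary R).
have [_ u'] := mulmx1_unit (@wmx_unitary R).
by rewrite -[RHS]mulmx1 -(mulmxV u') mulmxA wmx_unitary mul1mx.
Qed.

Lemma su2mx_e33_SU3 {R : realType} (a b x y : R) :
  a ^+ 2 + b ^+ 2 + x ^+ 2 + y ^+ 2 = 1 -> SU3 (su2mx a b x y + e33).
Proof.
move=> h; split.
  mx3_entries; rewrite ?mxE /=; complex_eq; try ring; rewrite -[RHS]h; ring.
rewrite det_mx33 !mxE /=.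
complex_eq; try ring; rewrite -[RHS]h; ring.
Qed.

Lemma su2mx_su3 {R : realType} (b x y : R) : su3 (su2mx 0 b x y).
Proof.
split.
  mx3_entries; rewrite ?mxE /=; complex_eq; ring.
rewrite /mxtrace !big_ord_recl big_ord0 !mxE /=.
by complex_eq; ring.
Qed.

Lemma wmx_su3 {R : realType} (Y : 'M[R[i]]_3) :
  su3 Y -> su3 (invmx (wmx R) *m Y *m wmx R).
Proof.
have wr : map_mx Num.conj (wmx R) = wmx R.
  by mx3_entries; rewrite ?rmorphN ?rmorph0 ?rmorph1.
move=> [Y1 Y2]; split.
  rewrite invmx_wmx /hadj !map_mxM !trmx_mul wr -map_trmx wr trmxK.
  by rewrite -mulmxA -/(hadj Y) Y1 mulNmx mulmxN mulmxA.
by rewrite -mulmxA mxtrace_mulC -mulmxA mulmxV ?mulmx1 //;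
  have [_] := mulmx1_unit (@wmx_unitary R).
Qed.

Lemma wmx_SU3 {R : realType} : SU3 (wmx R).
Proof.
split.
  mx3_entries; rewrite ?mxE /=; complex_eq; ring.
rewrite det_mx33 !mxE /=.
complex_eq; ring.
Qed.

Lemma SU3M {R : realType} (g h : 'M[R[i]]_3) : SU3 g -> SU3 h -> SU3 (g *m h).
Proof.
move=> [g1 gd] [h1 hd]; split; last by rewrite det_mulmx gd hd mulr1.
rewrite /unitary /hadj map_mxM trmx_mul mulmxA -[X in X *m _]mulmxA.
by rewrite -/(hadj h) h1 mulmx1.
Qed.

Lemma conn_su2mx {R : realType} (n : int) (p0 p1 p2 : R -> R) (r b x y : R) :
  conn n p0 p1 p2 r (su2mx 0 b x y) = p0 r * b + p1 r * x + p2 r * y.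
Proof. by rewrite /conn /zeta /kappa /nu !mxE /=; field. Qed.

(** For [b^2 + x^2 + y^2 = 1] the block of [su2mx 0 b x y] squares to -1, and this is its
    exponential at time [t], written in the form that [is_derive_curve] accepts. *)
Definition loop {R : realType} (b x y t : R) : 'M[R[i]]_3 :=
  (cos t)%:C *: su2mx 1 0 0 0 + (sin t)%:C *: su2mx 0 b x y + e33.

Lemma loopE {R : realType} (b x y t : R) :
  loop b x y t = su2mx (cos t) (sin t * b) (sin t * x) (sin t * y) + e33.
Proof.
congr (_ + _); mx3_entries; complex_eq; ring.
Qed.

Lemma loop_SU3 {R : realType} (b x y t : R) :
  b ^+ 2 + x ^+ 2 + y ^+ 2 = 1 -> SU3 (loop b x y t).
Proof.
move=> h; rewrite loopE; apply: su2mx_e33_SU3.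
by rewrite -(cos2Dsin2 t) -[sin t ^+ 2 in RHS]mulr1 -h; ring.
Qed.

(** The right side is the velocity of the loop. Its left-trivialised form is thus the constant
    [su2mx 0 b x y], and the invariant connection is constant along the loop. *)
Lemma loop_deriv {R : realType} (b x y t : R) : b ^+ 2 + x ^+ 2 + y ^+ 2 = 1 ->
  loop b x y t *m su2mx 0 b x y =
  (- sin t)%:C *: su2mx 1 0 0 0 + (cos t)%:C *: su2mx 0 b x y.
Proof.
(* Inserting the squared norm makes the identity polynomial in [b], [x], [y]. *)
move=> h; have E : - sin t = - sin t * (b ^+ 2 + x ^+ 2 + y ^+ 2).
  by rewrite h mulr1.
rewrite [in RHS]E loopE; mx3_entries; rewrite ?mxE /=; complex_eq; ring.
Qed.

(** * Connections and gauge transformations along the circles *)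

Lemma continuous_pair {T U V : topologicalType} (f : T -> U) (g : T -> V) :
  continuous f -> continuous g -> continuous (fun x => (f x, g x)).
Proof. move=> fc gc x; exact: (cvg_pair (fc x) (gc x)). Qed.

Lemma smooth_near_C1 {R : realType} {V : normedModType R} {M : set V}
    {f : V -> R} : smooth_near M f ->
  exists U : set V, [/\ open U, M `<=` U,
    forall x, U x -> {for x, continuous f},
    forall v x, U x -> derivable f x v
  & forall v x, U x -> {for x, continuous (fun x => 'D_v f x)}].
Proof.
move=> [U [oU MU /(_ 1) [fc fd]]]; exists U; split => // [v|v] x Ux.
  exact: (fd v).1.
exact: (fd v).2.1.
Qed.

(** Identifies the directional derivatives that occur in [darg], for a vector without radial part,
    with ordinary derivatives of [u] along the loop. *)
Lemma loop_speed {R : realType} (c : R[i] -> R)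
    {u : R -> 'M[R[i]]_3 -> R[i]} (r b x y t : R) :
  smooth_near [set p : R * ('M[R]_3 * 'M[R]_3) | 1 < p.1 /\ SU3 (cplx p.2)]
    (ucoord c u) ->
  1 < r -> b ^+ 2 + x ^+ 2 + y ^+ 2 = 1 ->
  is_derive t (1 : R) (fun t => c (u r (loop b x y t)))
    ('D_(0, reim (loop b x y t *m su2mx 0 b x y)) (ucoord c u)
      (r, reim (loop b x y t))).
Proof.
move=> /smooth_near_C1[U [oU MU _ fd fc]] r1 h.
pose P : R * ('M[R]_3 * 'M[R]_3) := (0, reim (su2mx 1 0 0 0)).
pose Q : R * ('M[R]_3 * 'M[R]_3) := (0, reim (su2mx 0 b x y)).
pose S : R * ('M[R]_3 * 'M[R]_3) := (r, reim e33).
have pt s : (r, reim (loop b x y s)) = cos s *: P + sin s *: Q + S.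
  rewrite /P /Q /S /loop !reimD !reimZ.
  by congr (_, _); rewrite /= !scaler0 !add0r.
have dt : (0, reim (loop b x y t *m su2mx 0 b x y)) =
    (- sin t) *: P + cos t *: Q.
  rewrite loop_deriv // reimD !reimZ.
  by congr (_, _); rewrite /= !scaler0 add0r.
have UM s : U (cos s *: P + sin s *: Q + S).
  by rewrite -pt; apply: MU; split => //=; rewrite cplx_reim; exact: loop_SU3.
have := @is_derive_curve R _ U (ucoord c u) P Q S cos sin t (- sin t) (cos t)
  oU fd fc (UM t) (is_derive_cos t) (is_derive_sin t).
rewrite -(derive_lin_comb _ _ _ _ _ _ _ oU fd fc (UM t)) -dt -pt.
rewrite (_ : (fun t => _) = (fun t => c (u r (loop b x y t)))) //.
by apply/funext => s; rewrite -pt /ucoord /= cplx_reim.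
Qed.

Lemma reim_loop {R : realType} (b x y t : R) (m : 'M[R[i]]_3) :
  reim (loop b x y t *m m) = cos t *: reim (su2mx 1 0 0 0 *m m)
    + sin t *: reim (su2mx 0 b x y *m m) + reim (e33 *m m).
Proof. by rewrite /loop !mulmxDl -!scalemxAl !reimD !reimZ. Qed.

Lemma reim_loop_continuous {R : realType} (b x y : R) (m : 'M[R[i]]_3) :
  continuous (fun t => reim (loop b x y t *m m)).
Proof.
move=> t; rewrite (_ : (fun t => _) = (fun t => cos t *: reim (su2mx 1 0 0 0 *m m)
    + sin t *: reim (su2mx 0 b x y *m m) + reim (e33 *m m))); last first.
  by apply/funext => s; exact: reim_loop.
apply: cvgD; last exact: cvg_cst.
apply: cvgD; apply: cvgZr_tmp; [exact: continuous_cos | exact: continuous_sin].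
Qed.

(** [alpha] is smooth across [xi = 0], so its derivative along [xi0] is bounded on the compact
    rectangle of pairs [(t, s)], which includes the zero section [s = 0]. *)
Lemma connection_lipschitz {R : realType} {k : int}
    {alpha : 'M[R[i]]_3 -> 'rV[R[i]]_2 -> 'M[R[i]]_3 -> 'rV[R[i]]_2 -> R}
    (b x y T S : R) (Y : 'M[R[i]]_3) :
  connection_on_Et k alpha -> su3 Y -> b ^+ 2 + x ^+ 2 + y ^+ 2 = 1 ->
  exists L : R, forall t s s', t \in `[0, T] -> s \in `[0, S] -> s' \in `[0, S] ->
    `|alpha (loop b x y t *m wmx R) (s%:C *: xi0 R) Y 0
      - alpha (loop b x y t *m wmx R) (s'%:C *: xi0 R) Y 0| <= L * `|s - s'|.
Proof.
move=> [_ sm _ _] Y3 h; have /smooth_near_C1[U [oU MU _ fd fc]] := sm Y 0 Y3.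
set f := fun p => _ in fd fc.
pose V : normedModType R := (('M[R]_3 * 'M[R]_3) * ('rV[R]_2 * 'rV[R]_2))%type.
pose G (t : R) : V := (reim (loop b x y t *m wmx R), 0).
pose W : V := (0, reim (xi0 R)).
have fG t s : f (G t + s *: W) =
    alpha (loop b x y t *m wmx R) (s%:C *: xi0 R) Y 0.
  rewrite /f /= scaler0 addr0 add0r -reimZ.
  by rewrite !cplx_reim.
have UG t s : U (G t + s *: W).
  apply: MU; rewrite /= scaler0 addr0 cplx_reim.
  by apply: SU3M wmx_SU3; exact: loop_SU3.
have Gc : continuous (fun p : R * R => G p.1 + p.2 *: W).
  move=> p; apply: cvgD; last by apply: cvgZr_tmp; exact: cvg_snd.
  apply: (@continuous_comp _ _ _ fst G p); first exact: cvg_fst.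
  apply: continuous_pair; [exact: reim_loop_continuous | exact: cst_continuous].
have Dc : continuous (fun p : R * R => 'D_W f (G p.1 + p.2 *: W)).
  move=> p; apply: (@continuous_comp _ _ _ (fun p : R * R => G p.1 + p.2 *: W)
    (fun z => 'D_W f z) p); first exact: Gc.
  by apply: fc; exact: UG.
have [L HL] := bounded_on_rectangle _ T S Dc.
exists L => t s s' tT sS s'S; rewrite -!fG.
have := @increment_bound R V f (G t) W 0 L s' s.
rewrite mul0r subr0; apply => z zs; split; first by apply: fd; exact: UG.
rewrite subr0; apply: (HL t z) => //.
move: zs sS s'S; rewrite !in_itv /=; have [ss|ss] := leP s' s;
  move=> /andP[z1 z2] /andP[? ?] /andP[? ?]; apply/andP; split; lra.
Qed.

Lemma U1_sumsq {R : realType} (z : R[i]) :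
  U1 z -> complex.Re z ^+ 2 + complex.Im z ^+ 2 = 1.
Proof.
rewrite /U1 normc_def => -[h].
by rewrite -[LHS]sqr_sqrtr ?h ?expr1n // addr_ge0 // sqr_ge0.
Qed.

(** The condition [rho r <= 1] confines the covectors to a compact segment ending on the zero
    section; [L] is fixed before [r], while the neighbourhood of [r] depends on the gauge [u]. *)
Lemma extends_locally_lipschitz {R : realType} {n k : int} {p0 p1 p2 : R -> R}
    (b x y : R) :
  b ^+ 2 + x ^+ 2 + y ^+ 2 = 1 -> extends_to_Et n k p0 p1 p2 ->
  exists L : R, forall r, 1 < r -> rho r <= 1 ->
    \forall r' \near r, 1 < r' -> rho r' <= 1 ->
    `|(p0 r * b + p1 r * x + p2 r * y) - (p0 r' * b + p1 r' * x + p2 r' * y)|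
      <= L * `|rho r - rho r'|.
Proof.
move=> h [alpha [u [conn_alpha [u1 smR smI _] E]]].
have Y3 := su2mx_su3 b x y.
have [L HL] := connection_lipschitz b x y (pi *+ 2) 1 _ conn_alpha (wmx_su3 _ Y3) h.
exists L => r r1 rho1.
have lSU t : SU3 (loop b x y t) by exact: loop_SU3.
pose N c (p : R * R) := ucoord c u (p.1, reim (loop b x y p.2)).
have NE c p : N c p = c (u p.1 (loop b x y p.2)) by rewrite /N /ucoord /= cplx_reim.
have sq r' t : 1 < r' ->
    N (@complex.Re R) (r', t) ^+ 2 + N (@complex.Im R) (r', t) ^+ 2 = 1.
  by move=> r'1; rewrite !NE; apply: U1_sumsq; exact: u1.
pose M := [set p : R * ('M[R]_3 * 'M[R]_3) | 1 < p.1 /\ SU3 (cplx p.2)].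
have Nc c t : smooth_near M (ucoord c u) ->
    {for (r, t), continuous (N c)}.
  move=> /smooth_near_C1[U [oU MU uc _ _]].
  apply: (@continuous_comp _ _ _ (fun p : R * R => (p.1, reim (loop b x y p.2)))
    (ucoord c u) (r, t)).
    apply: (@continuous_pair (R * R)%type R ('M[R]_3 * 'M[R]_3)%type
      fst (fun p => reim (loop b x y p.2))); first by move=> ?; exact: cvg_fst.
    move=> p; apply: (@continuous_comp _ _ _ snd (fun t => reim (loop b x y t)) p).
      exact: cvg_snd.
    rewrite (_ : (fun t => reim (loop b x y t)) =
      (fun t => reim (loop b x y t *m 1%:M))); first exact: reim_loop_continuous.
    by apply/funext => ?; rewrite mulmx1.
  by apply: uc; apply: MU; split => //=; rewrite cplx_reim.
(* The real part of the quotient of the loops at [r] and at [p.1]. It equals 1 for [p.1 = r], hence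
   stays positive nearby, uniformly in [t]. *)
pose H (p : R * R) := N (@complex.Re R) (r, p.2) * N (@complex.Re R) p
  + N (@complex.Im R) (r, p.2) * N (@complex.Im R) p.
have Hc t : {for (r, t), continuous H}.
  have sl c : smooth_near M (ucoord c u) ->
      {for (r, t), continuous (fun p : R * R => N c (r, p.2))}.
    move=> sm; apply: (@continuous_comp _ _ _ (fun p : R * R => (r, p.2)) (N c) (r, t)).
      apply: (@continuous_pair (R * R)%type R R (fun=> r) snd).
        exact: cst_continuous.
      by move=> ?; exact: cvg_snd.
    exact: Nc.
  by apply: cvgD; apply: cvgM; by [exact: sl | exact: Nc].
have H0 t : 0 < H (r, t) by rewrite /H /= -!expr2 sq // ltr01.
have nr := near_segment H r (pi *+ 2) Hc H0.
near=> r' => r'1 rho'1.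
have HN : forall t, t \in `[0, pi *+ 2] -> 0 < H (r', t) by near: r'.
have sp c r0 t := @loop_speed R c u r0 b x y t.
pose D c r0 t := 'D_(0, reim (loop b x y t *m su2mx 0 b x y)) (ucoord c u)
  (r0, reim (loop b x y t)).
have per : loop b x y (pi *+ 2) = loop b x y 0.
  by rewrite /loop cos2pi sin2pi cos0 sin0.
have sqt r0 t : 1 < r0 -> complex.Re (u r0 (loop b x y t)) ^+ 2
    + complex.Im (u r0 (loop b x y t)) ^+ 2 = 1.
  by move=> r01; have := sq r0 t r01; rewrite !NE.
have [|||||t tT speeds] := @loops_same_speed R
  (fun t => complex.Re (u r (loop b x y t)))
  (fun t => complex.Im (u r (loop b x y t)))
  (fun t => complex.Re (u r' (loop b x y t)))
  (fun t => complex.Im (u r' (loop b x y t)))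
  (D (@complex.Re R) r) (D (@complex.Im R) r)
  (D (@complex.Re R) r') (D (@complex.Im R) r') (pi *+ 2)
  (mulrn_wgt0 _ (pi_gt0 R)) (fun t => sp _ r t smR r1 h) (fun t => sp _ r t smI r1 h)
  (fun t => sp _ r' t smR r'1 h) (fun t => sp _ r' t smI r'1 h)
  (fun t => sqt r t r1) (fun t => sqt r' t r'1).
- by rewrite per.
- by rewrite per.
- by rewrite per.
- by rewrite per.
- by move=> t /HN; rewrite /H !NE.
(* With radial component 0 both values of [alpha] have [tau = 0]; the [darg] terms cancel because
   the speeds agree at [t]. *)
have := E r (loop b x y t) 0 _ r1 (lSU t) Y3.
have := E r' (loop b x y t) 0 _ r'1 (lSU t) Y3.
rewrite !mul0r !scale0r !conn_su2mx => -> ->.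
rewrite /darg -!/(D _ _ _) speeds [- (alpha _ _ _ _ - _)]opprB addrA subrK.
by apply: HL; rewrite ?in_itv /= ?sqrtr_ge0.
Unshelve. all: by end_near. Qed.

(** * Smooth functions on a normed space *)

Lemma CkS {R : realType} {V : normedModType R} (k : nat) (U : set V) (f : V -> R) :
  Ck k.+1 U f -> Ck k U f.
Proof.
elim: k f => [|k IH] f [fc fd]; split => // v.
by have [fv fk] := fd v; split => //; exact: IH.
Qed.

Lemma Ck_ext {R : realType} {V : normedModType R} (k : nat) (f g : V -> R) :
  (forall x, f x = g x) -> Ck k setT g -> Ck k setT f.
Proof. by move=> /funext ->. Qed.

Lemma Ck_cst {R : realType} {V : normedModType R} (k : nat) (c : R) :
  Ck k setT (fun _ : V => c).
Proof.
elim: k c => [|k IH] c; (split; first by move=> x _; exact: cvg_cst) => //= v.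
split => [x _|]; first exact: derivable_cst.
by apply: (Ck_ext _ _ (fun=> 0)) => // x; exact: derive_cst.
Qed.

Lemma Ck_linear {R : realType} {V : normedModType R} (k : nat) (f : V -> R) :
  (forall a u v, f (a *: u + v) = a * f u + f v) -> continuous f ->
  Ck k setT f.
Proof.
move=> fl fc; case: k => [|k]; (split; first by move=> x _; exact: fc) => // v.
have D x : is_derive x v f (f v).
  have E : \forall h \near 0^', f v = h^-1 *: ((f \o shift x) (h *: v) - f x).
    near=> h; rewrite /= fl addrK /GRing.scale /= mulKf //.
    by near: h; exact: nbhs_dnbhs_neq.
  have L : h^-1 *: ((f \o shift x) (h *: v) - f x) @[h --> 0^'] --> f v.
    by apply: cvg_trans (near_eq_cvg E) _; exact: cvg_cst.
  by split; [apply/cvg_ex; exists (f v) | exact: cvg_lim L].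
split => [x _|]; first by have [] := D x.
by apply: (Ck_ext _ _ (fun=> f v)) (Ck_cst _ _) => x; have [] := D x.
Unshelve. all: by end_near. Qed.

Lemma CkD {R : realType} {V : normedModType R} (k : nat) (f g : V -> R) :
  Ck k setT f -> Ck k setT g -> Ck k setT (fun x => f x + g x).
Proof.
elim: k f g => [|k IH] f g [fc fd] [gc gd];
  (split; first by move=> x _; exact: cvgD (fc x I) (gc x I)) => // v.
have [fv fk] := fd v; have [gv gk] := gd v.
split => [x _|]; first exact: derivableD (fv x I) (gv x I).
apply: (Ck_ext _ _ (fun x => 'D_v f x + 'D_v g x)) (IH _ _ fk gk) => x.
exact: deriveD (fv x I) (gv x I).
Qed.

Lemma CkM {R : realType} {V : normedModType R} (k : nat) (f g : V -> R) :
  Ck k setT f -> Ck k setT g -> Ck k setT (fun x => f x * g x).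
Proof.
elim: k f g => [|k IH] f g fC gC; have [fc fd] := fC; have [gc gd] := gC;
  (split; first by move=> x _; exact: cvgM (fc x I) (gc x I)) => // v.
have [fv fk] := fd v; have [gv gk] := gd v.
split => [x _|]; first exact: derivableM (fv x I) (gv x I).
apply: (Ck_ext _ _ (fun x => f x * 'D_v g x + g x * 'D_v f x)) => [x|].
  exact: deriveM (fv x I) (gv x I).
by apply: CkD; apply: IH => //; exact: CkS.
Qed.

Lemma CkV {R : realType} {V : normedModType R} (k : nat) (f : V -> R) :
  (forall x, f x != 0) -> Ck k setT f -> Ck k setT (fun x => (f x)^-1).
Proof.
move=> f0; elim: k f f0 => [|k IH] f f0 fC; have [fc fd] := fC;
  (split; first by move=> x _; exact: cvgV (f0 x) (fc x I)) => // v.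
have [fv fk] := fd v.
split => [x _|]; first exact: derivableV (f0 x) (fv x I).
apply: (Ck_ext _ _ (fun x => -1 * ((f x)^-1 * (f x)^-1) * 'D_v f x)) => [x|].
  rewrite (deriveV (f0 x) (fv x I)) /GRing.scale /=.
  by rewrite mulN1r expr2 invfM.
apply: CkM => //; apply: CkM; first exact: Ck_cst.
by apply: CkM; apply: IH => //; exact: CkS.
Qed.

Lemma Ck_sqrt {R : realType} {V : normedModType R} (k : nat) (f : V -> R) :
  (forall x, 0 < f x) -> Ck k setT f -> Ck k setT (fun x => Num.sqrt (f x)).
Proof.
move=> f0; elim: k => [|k IH] fC; have [fc fd] := fC;
  (split; first by move=> x _; apply: (@continuous_comp _ _ _ f Num.sqrt x);
   [exact: fc | exact: sqrt_continuous]) => // v.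
have [fv fk] := fd v.
have D x : is_derive x v (fun x => Num.sqrt (f x))
    ((2 * Num.sqrt (f x))^-1 * 'D_v f x).
  apply: (is_derive_comp1 f Num.sqrt).
    by split=> //; exact: fv.
  by apply: is_derive1_sqrt.
split => [x _|]; first by have [] := D x.
apply: (Ck_ext _ _ (fun x => (2 * Num.sqrt (f x))^-1 * 'D_v f x)) => [x|].
  by have [] := D x.
apply: CkM => //; apply: CkV.
  by move=> x; rewrite mulf_neq0 ?pnatr_eq0 // sqrtr_eq0 -ltNge.
by apply: CkM; [exact: Ck_cst | apply: IH; exact: CkS].
Qed.

(** * Smooth connections on the extension *)

Definition smoothC {R : realType} {V : normedModType R} (F : V -> R[i]) : Prop :=
  forall k, Ck k setT (fun p => complex.Re (F p)) /\
            Ck k setT (fun p => complex.Im (F p)).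

Lemma smoothC_cst {R : realType} {V : normedModType R} (c : R[i]) :
  smoothC (fun _ : V => c).
Proof. by move=> k; split; exact: Ck_cst. Qed.

Lemma smoothCD {R : realType} {V : normedModType R} (F G : V -> R[i]) :
  smoothC F -> smoothC G -> smoothC (fun p => F p + G p).
Proof.
move=> sF sG k; have [F1 F2] := sF k; have [G1 G2] := sG k.
by split; [apply: Ck_ext (CkD _ _ _ F1 G1) | apply: Ck_ext (CkD _ _ _ F2 G2)] => p;
  case: (F p); case: (G p).
Qed.

Lemma smoothCM {R : realType} {V : normedModType R} (F G : V -> R[i]) :
  smoothC F -> smoothC G -> smoothC (fun p => F p * G p).
Proof.
move=> sF sG k; have [F1 F2] := sF k; have [G1 G2] := sG k.
have N f : Ck k setT f -> Ck k setT (fun p : V => -1 * f p).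
  by move=> ?; apply: CkM => //; exact: Ck_cst.
split.
  apply: Ck_ext (CkD _ _ _ (CkM _ _ _ F1 G1) (N _ (CkM _ _ _ F2 G2))) => p.
  by rewrite mulN1r; case: (F p); case: (G p).
apply: Ck_ext (CkD _ _ _ (CkM _ _ _ F1 G2) (CkM _ _ _ F2 G1)) => p.
by case: (F p); case: (G p).
Qed.

Lemma smoothC_conj {R : realType} {V : normedModType R} (F : V -> R[i]) :
  smoothC F -> smoothC (fun p => Num.conj (F p)).
Proof.
move=> sF k; have [F1 F2] := sF k; split; first by apply: Ck_ext F1 => p; case: (F p).
apply: Ck_ext (CkM _ _ _ (Ck_cst _ (-1)) F2) => p.
by rewrite mulN1r; case: (F p).
Qed.

Lemma smoothC_coord {R : realType} {V : normedModType R} {n : nat} (j : 'I_n) :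
  smoothC (fun p : V * ('rV[R]_n * 'rV[R]_n) => cplx p.2 0 j).
Proof.
move=> k; split.
  apply: (Ck_ext _ _ (fun p : V * ('rV[R]_n * 'rV[R]_n) => p.2.1 0 j)) => [p|].
    by rewrite mxE.
  apply: Ck_linear => [a u v|]; first by rewrite !mxE.
  move=> p; apply: (@continuous_comp _ _ _ snd
    (fun q : 'rV[R]_n * 'rV[R]_n => q.1 0 j) p); first exact: cvg_snd.
  apply: (@continuous_comp _ _ _ fst (fun q : 'rV[R]_n => q 0 j) p.2).
    exact: cvg_fst.
  exact: coord_continuous.
apply: (Ck_ext _ _ (fun p : V * ('rV[R]_n * 'rV[R]_n) => p.2.2 0 j)) => [p|].
    by rewrite mxE.
apply: Ck_linear => [a u v|]; first by rewrite !mxE.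
move=> p; apply: (@continuous_comp _ _ _ snd
    (fun q : 'rV[R]_n * 'rV[R]_n => q.2 0 j) p); first exact: cvg_snd.
apply: (@continuous_comp _ _ _ snd (fun q : 'rV[R]_n => q 0 j) p.2).
    exact: cvg_snd.
exact: coord_continuous.
Qed.

Lemma smoothC_sum {R : realType} {V : normedModType R} {n : nat}
    (F : 'I_n -> V -> R[i]) :
  (forall i, smoothC (F i)) -> smoothC (fun p => \sum_i F i p).
Proof.
move=> sF; elim: (index_enum _) => [|i s IH].
  by rewrite (_ : (fun p => _) = (fun=> 0)); [exact: smoothC_cst |
    apply/funext => p; rewrite big_nil].
rewrite (_ : (fun p => _) = (fun p => F i p + \sum_(j <- s) F j p)).
  exact: smoothCD.
by apply/funext => p; rewrite big_cons.
Qed.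

Definition sqnorm {R : realType} (xi : 'rV[R[i]]_2) : R :=
  complex.Re ((xi *m hadj xi) 0 0).

(* The pairing <D xi, xi>, where D xi = tau - xi . B is the covariant derivative
   of xi for the homogeneous connection of CP^2. *)
Definition vertical {R : realType} (xi : 'rV[R[i]]_2) (Y : 'M[R[i]]_3)
    (tau : 'rV[R[i]]_2) : R[i] :=
  ((tau - liecoact xi (@ulsubmx _ 2 1 2 1 Y)) *m hadj xi) 0 0.

(** Its real part is the Liouville form of the cotangent bundle; its imaginary part is the same form
    after multiplying the column by [-i]. *)
Definition tautological {R : realType} (xi : 'rV[R[i]]_2) (Y : 'M[R[i]]_3) : R[i] :=
  (xi *m @ursubmx _ 2 1 2 1 Y) 0 0.

(* On X^* one has w = r^2, and (w (1 + w))^-1 = (1 - w^-1) / |xi|^2 has no pole on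
   the zero section. *)
Definition model {R : realType} (k : int) (c0 c1 c2 : R) (h : 'M[R[i]]_3)
    (xi : 'rV[R[i]]_2) (Y : 'M[R[i]]_3) (tau : 'rV[R[i]]_2) : R :=
  let w := Num.sqrt (1 + sqnorm xi) in
  k%:~R * complex.Im (\tr (@ulsubmx _ 2 1 2 1 Y))
  + (k%:~R / 2 * (w * (1 + w))^-1 + c0 / 2 * w^-1) * complex.Im (vertical xi Y tau)
  + c1 * complex.Re (tautological xi Y) + c2 * complex.Im (tautological xi Y).

Lemma hadjE {R : realType} {m n : nat} (A : 'M[R[i]]_(m, n)) i j :
  hadj A j i = Num.conj (A i j).
Proof. by rewrite !mxE. Qed.

Lemma sqnorm_ge0 {R : realType} (xi : 'rV[R[i]]_2) : 0 <= sqnorm xi.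
Proof.
rewrite /sqnorm mxE (raddf_sum (@complex.Re R)); apply: sumr_ge0 => j _; rewrite !mxE.
by case: (xi 0 j) => a b /=; rewrite mulrN opprK addr_ge0 // -expr2 sqr_ge0.
Qed.

Lemma model_linear {R : realType} (k : int) (c0 c1 c2 : R) (h : 'M[R[i]]_3)
    (xi : 'rV[R[i]]_2) (a : R) (Y Z : 'M[R[i]]_3) (tau ups : 'rV[R[i]]_2) :
  model k c0 c1 c2 h xi (a%:C *: Y + Z) (a%:C *: tau + ups) =
  a * model k c0 c1 c2 h xi Y tau + model k c0 c1 c2 h xi Z ups.
Proof.
have ReZ (z z' : R[i]) : complex.Re (a%:C * z + z') = a * complex.Re z + complex.Re z'.
  by case: z z' => [? ?] [? ?] /=; ring.
have ImZ (z z' : R[i]) : complex.Im (a%:C * z + z') = a * complex.Im z + complex.Im z'.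
  by case: z z' => [? ?] [? ?] /=; ring.
have ur : @ursubmx _ 2 1 2 1 (a%:C *: Y + Z) =
    a%:C *: @ursubmx _ 2 1 2 1 Y + @ursubmx _ 2 1 2 1 Z.
  by apply/matrixP => i j; rewrite !mxE.
have ul : @ulsubmx _ 2 1 2 1 (a%:C *: Y + Z) =
    a%:C *: @ulsubmx _ 2 1 2 1 Y + @ulsubmx _ 2 1 2 1 Z.
  by apply/matrixP => i j; rewrite !mxE.
have trD : \tr (@ulsubmx _ 2 1 2 1 (a%:C *: Y + Z)) =
    a%:C * \tr (@ulsubmx _ 2 1 2 1 Y) + \tr (@ulsubmx _ 2 1 2 1 Z).
  by rewrite ul mxtraceD mxtraceZ.
have lin (M N : 'M[R[i]]_1) : (a%:C *: M + N) 0 0 = a%:C * M 0 0 + N 0 0.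
  by rewrite !mxE.
have ta : tautological xi (a%:C *: Y + Z) =
    a%:C * tautological xi Y + tautological xi Z.
  by rewrite /tautological ur mulmxDr -scalemxAr lin.
have co (s t : R[i]) (M N : 'M[R[i]]_2) :
    a%:C *: tau + ups - ((a%:C * s + t) *: xi + xi *m (a%:C *: M + N)) =
    a%:C *: (tau - (s *: xi + xi *m M)) + (ups - (t *: xi + xi *m N)).
  rewrite mulmxDr -scalemxAr scalerDl scalerBr scalerDr scalerA.
  by rewrite [X in _ - X]addrACA opprD addrACA.
have ve : vertical xi (a%:C *: Y + Z) (a%:C *: tau + ups) =
    a%:C * vertical xi Y tau + vertical xi Z ups.
  by rewrite /vertical /liecoact trD ul co mulmxDl -scalemxAl lin.
have comb (K q t t' v v' x x' y y' : R) :
    K * (a * t + t') + q * (a * v + v') + c1 * (a * x + x') + c2 * (a * y + y') =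
    a * (K * t + q * v + c1 * x + c2 * y) + (K * t' + q * v' + c1 * x' + c2 * y').
  by ring.
rewrite /model trD ta ve !ImZ !ReZ; exact: comb.
Qed.

(** All ingredients are polynomials in the coordinates of [xi] and their conjugates, except the root
    [w], whose radicand [1 + sqnorm xi] is positive everywhere. *)
Lemma model_smooth {R : realType} (k : int) (c0 c1 c2 : R)
    (Y : 'M[R[i]]_3) (tau : 'rV[R[i]]_2) :
  smooth_near
    [set p : ('M[R]_3 * 'M[R]_3) * ('rV[R]_2 * 'rV[R]_2) | SU3 (cplx p.1)]
    (fun p => model k c0 c1 c2 (cplx p.1) (cplx p.2) Y tau).
Proof.
exists setT; split => //; first exact: openT.
move=> m.
pose V : normedModType R := (('M[R]_3 * 'M[R]_3) * ('rV[R]_2 * 'rV[R]_2))%type.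
have X j : smoothC (fun p : V => cplx p.2 0 j) := smoothC_coord j.
have Xc j : smoothC (fun p : V => Num.conj (cplx p.2 0 j)) := smoothC_conj _ (X j).
have N : Ck m setT (fun p : V => sqnorm (cplx p.2)).
  apply: (Ck_ext _ _ (fun p : V =>
      complex.Re (\sum_j cplx p.2 0 j * Num.conj (cplx p.2 0 j)))) => [p|].
    by rewrite /sqnorm mxE; congr complex.Re; apply: eq_bigr => j _; rewrite hadjE.
  by apply: (smoothC_sum _ _ m).1 => j; exact: smoothCM.
have vs : smoothC (fun p : V => vertical (cplx p.2) Y tau).
  rewrite (_ : (fun p => _) = (fun p : V => \sum_j (tau 0 j + -1 *
      (\tr (@ulsubmx _ 2 1 2 1 Y) * cplx p.2 0 j
       + \sum_i cplx p.2 0 i * @ulsubmx _ 2 1 2 1 Y i j))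
      * Num.conj (cplx p.2 0 j))).
    apply: smoothC_sum => j; apply: smoothCM => //.
    apply: smoothCD; first exact: smoothC_cst.
    apply: smoothCM; first exact: smoothC_cst.
    apply: smoothCD; first by apply: smoothCM => //; exact: smoothC_cst.
    by apply: smoothC_sum => i; apply: smoothCM => //; exact: smoothC_cst.
  apply/funext => p; rewrite /vertical /liecoact mxE; apply: eq_bigr => j _.
  by rewrite hadjE mulN1r; congr (_ * _); rewrite !mxE.
have ts : smoothC (fun p : V => tautological (cplx p.2) Y).
  rewrite (_ : (fun p => _) =
      (fun p : V => \sum_i cplx p.2 0 i * @ursubmx _ 2 1 2 1 Y i 0)).
    by apply: smoothC_sum => j; apply: smoothCM => //; exact: smoothC_cst.
  by apply/funext => p; rewrite /tautological mxE.
have w0 (p : V) : 0 < 1 + sqnorm (cplx p.2) by rewrite ltr_wpDr // sqnorm_ge0.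
have sw : Ck m setT (fun p : V => Num.sqrt (1 + sqnorm (cplx p.2))).
  by apply: Ck_sqrt => //; apply: CkD => //; exact: Ck_cst.
have swp (p : V) : 0 < Num.sqrt (1 + sqnorm (cplx p.2)) by rewrite sqrtr_gt0.
apply: CkD; [apply: CkD; [apply: CkD|]|].
- exact: Ck_cst.
- apply: CkM; last exact: (vs m).2.
  apply: CkD; (apply: CkM; first exact: Ck_cst); apply: CkV => //.
  + by move=> p; rewrite mulf_neq0 // lt0r_neq0 // addr_gt0.
  + by apply: CkM => //; apply: CkD => //; exact: Ck_cst.
  + by move=> p; rewrite lt0r_neq0.
- by apply: CkM; [exact: Ck_cst | exact: (ts m).1].
- by apply: CkM; [exact: Ck_cst | exact: (ts m).2].
Qed.

(** [A] acts on [xi] through the unitary matrix [\det A *: A], and on the upper right block of [Y]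
    through the inverse matrix from the left; hence the norm, the pairing and the trace are all
    preserved. *)
Lemma model_invariant {R : realType} (k : int) (c0 c1 c2 : R) (A : 'M[R[i]]_2)
    (h : 'M[R[i]]_3) (xi : 'rV[R[i]]_2) (Y : 'M[R[i]]_3) (tau : 'rV[R[i]]_2) :
  unitary A ->
  model k c0 c1 c2 (h *m embH A) (coact xi A)
    (invmx (embH A) *m Y *m embH A) (coact tau A) = model k c0 c1 c2 h xi Y tau.
Proof.
move=> uA; have uA' : hadj A *m A = 1%:M by exact: mulmx1C.
have dd : Num.conj (\det A) * \det A = 1.
  have := congr1 determinant uA'.
  by rewrite det_mulmx det1 /hadj det_tr det_map_mx.
have dd' : \det A * Num.conj (\det A) = 1 by rewrite mulrC.
pose E' : 'M[R[i]]_3 :=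
  (block_mx (hadj A) 0 0 ((\det A)%:M : 'M[R[i]]_1) : 'M[R[i]]_(2 + 1)).
have E'E : E' *m embH A = 1%:M.
  rewrite /E' /embH (@mulmx_block _ 2 1 2 1 2 1) !mulmx0 !mul0mx addr0 !add0r uA'.
  by rewrite -scalar_mxM dd'; exact: esym (scalar_mx_block 2 1 1).
have iE : invmx (embH A) = E'.
  have [_ u] := mulmx1_unit E'E.
  by rewrite -[RHS]mulmx1 -(mulmxV u) mulmxA E'E mul1mx.
(* The blocks of [Y] conjugated by [embH A]; the factors [\det A] come from the lower right
   entry. *)
pose Y' : 'M[R[i]]_3 := (block_mx
    (hadj A *m @ulsubmx _ 2 1 2 1 Y *m A)
    (Num.conj (\det A) *: (hadj A *m @ursubmx _ 2 1 2 1 Y))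
    (\det A *: (@dlsubmx _ 2 1 2 1 Y *m A)) (@drsubmx _ 2 1 2 1 Y) : 'M[R[i]]_(2 + 1)).
have YE : E' *m Y *m embH A = Y'.
  rewrite -{1}[Y](@submxK _ 2 1 2 1) /E' /embH /Y' !(@mulmx_block _ 2 1 2 1 2 1).
  rewrite !mulmx0 !mul0mx !addr0 !add0r !mul_mx_scalar !mul_scalar_mx.
  by rewrite -!scalemxAl scalerA dd scale1r.
rewrite iE YE.
have hco : hadj (coact xi A) = Num.conj (\det A) *: (hadj A *m hadj xi).
  by rewrite /coact /hadj map_mxZ linearZ /= map_mxM trmx_mul.
have trB : \tr (hadj A *m @ulsubmx _ 2 1 2 1 Y *m A) = \tr (@ulsubmx _ 2 1 2 1 Y).
  by rewrite -mulmxA mxtrace_mulC -mulmxA uA mulmx1.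
have AA (M : 'rV[R[i]]_2) : M *m A *m (hadj A) = M by rewrite -mulmxA uA mulmx1.
have sq : sqnorm (coact xi A) = sqnorm xi.
  rewrite /sqnorm hco /coact -scalemxAr -scalemxAl scalerA dd scale1r.
  by rewrite mulmxA AA.
have ta : tautological (coact xi A) Y' = tautological xi Y.
  rewrite /tautological block_mxKur /coact -scalemxAr -scalemxAl scalerA dd scale1r.
  by rewrite mulmxA AA.
have ve : vertical (coact xi A) Y' (coact tau A) = vertical xi Y tau.
  rewrite /vertical block_mxKul /liecoact trB.
  have -> : coact tau A - (\tr (@ulsubmx _ 2 1 2 1 Y) *: coact xi A
      + coact xi A *m (hadj A *m @ulsubmx _ 2 1 2 1 Y *m A)) =
      coact (tau - (\tr (@ulsubmx _ 2 1 2 1 Y) *: xi + xi *m @ulsubmx _ 2 1 2 1 Y)) A.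
    rewrite /coact !mulmxA -!scalemxAl AA mulmxBl mulmxDl scalerBr scalerDr.
    by rewrite -scalemxAl !scalerA mulrC.
  rewrite hco /coact -scalemxAr -scalemxAl scalerA dd scale1r.
  by rewrite mulmxA AA.
by rewrite /model sq ta ve block_mxKul trB.
Qed.

(** Along the H-orbits the covariant derivative of [xi] and the upper right block both vanish, which
    leaves the trace term. *)
Lemma model_vertical {R : realType} (k : int) (c0 c1 c2 : R) (B : 'M[R[i]]_2)
    (h : 'M[R[i]]_3) (xi : 'rV[R[i]]_2) :
  model k c0 c1 c2 h xi (lieH B) (liecoact xi B) = k%:~R * complex.Im (\tr B).
Proof.
rewrite /model /vertical /tautological /lieH block_mxKul block_mxKur.
by rewrite subrr mul0mx mulmx0 !mxE /= !mulr0 !addr0.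
Qed.

Lemma model_connection {R : realType} (k : int) (c0 c1 c2 : R) :
  connection_on_Et k (model k c0 c1 c2).
Proof.
split=> *; [exact: model_linear | exact: model_smooth | exact: model_invariant |
  exact: model_vertical].
Qed.

(** * Pullback of the model to the principal locus *)

Lemma rho_sq {R : realType} (r : R) : 1 < r -> rho r ^+ 2 = r ^+ 4 - 1.
Proof.
by move=> r1; rewrite sqr_sqrtr // subr_ge0 exprn_ege1 // ltW.
Qed.

Lemma rho_gt0 {R : realType} (r : R) : 1 < r -> 0 < rho r.
Proof. by move=> r1; rewrite sqrtr_gt0 subr_gt0 exprn_egt1. Qed.

(** Up to signs the last two indices are exchanged. The entry [Y 0 1], which is [nu], lands in the
    upper right block, so the tautological form sees [nu]. *)
Lemma conj_wmx {R : realType} (Y : 'M[R[i]]_3) :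
  invmx (wmx R) *m Y *m wmx R =
  mx3 [:: [:: Y 0 0; - Y 0 2; Y 0 1]; [:: - Y 2 0; Y 2 2; - Y 2 1];
          [:: Y 1 0; - Y 1 2; Y 1 1]].
Proof.
rewrite invmx_wmx; apply/matrixP => i j.
rewrite !mxE !big_ord_recl big_ord0 !mxE !big_ord_recl !big_ord0 !mxE.
do ![rewrite [lift _ _](_ : _ = 1); last exact: val_inj
    |rewrite [lift _ _](_ : _ = 2); last exact: val_inj].
rewrite [ord0](_ : _ = 0); last exact: val_inj.
case: i => [[|[|[|//]]] ?]; case: j => [[|[|[|//]]] ?] /=;
  rewrite !(mulr0, mul0r, mulr1, mul1r, mulrN1, mulN1r, addr0, add0r, opprK) //.
Qed.

(** Here [w = r^2]. The trace term gives [-k (zeta - kappa)], and [k / (2 w (1 + w))] times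
    [-2 (r^4 - 1) kappa] is [(-k + k / r^2) kappa]; the [kappa] terms add up to [k / r^2], that is
    [-n / r^2] for [n = -k]. *)
Lemma model_pullback {R : realType} (k : int) (c0 c1 c2 : R) (h : 'M[R[i]]_3)
    (r e : R) (Y : 'M[R[i]]_3) : 1 < r -> su3 Y ->
  model k c0 c1 c2 h ((rho r)%:C *: xi0 R) (invmx (wmx R) *m Y *m wmx R)
    (e%:C *: xi0 R) =
  (- k)%:~R * zeta Y
  + (- ((- k)%:~R / r ^+ 2) + c0 * ((1 - r ^+ 4) / r ^+ 2)) * kappa Y
  + c1 * rho r * complex.Re (nu Y) + c2 * rho r * complex.Im (nu Y).
Proof.
move=> r1 [_ trY]; have r0 : r != 0 by rewrite lt0r_neq0 // (lt_trans ltr01).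
have sq : sqnorm ((rho r)%:C *: xi0 R) = r ^+ 4 - 1.
  rewrite /sqnorm mxE !big_ord_recl big_ord0 !hadjE !mxE /= -rho_sq //.
  by rewrite !(mulr0, mul0r, mulr1, mul1r, subr0, addr0, oppr0); ring.
have w2 : Num.sqrt (1 + sqnorm ((rho r)%:C *: xi0 R)) = r ^+ 2.
  rewrite sq addrC subrK (_ : r ^+ 4 = (r ^+ 2) ^+ 2); last by rewrite -exprM.
  by rewrite sqrtr_sqr ger0_norm // sqr_ge0.
have tY : complex.Im (Y 2 2) = - complex.Im (Y 0 0) - complex.Im (Y 1 1).
  move/(congr1 (@complex.Im R)): trY; rewrite /mxtrace !big_ord_recl big_ord0.
  do ![rewrite [lift _ _](_ : _ = 1); last exact: val_inj
      |rewrite [lift _ _](_ : _ = 2); last exact: val_inj].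
  by case: (Y 0 0) (Y 1 1) (Y 2 2) => [? ?] [? ?] [? ?] /=; lra.
rewrite conj_wmx; set Z := mx3 _.
have trZ : \tr (@ulsubmx _ 2 1 2 1 Z) = Y 0 0 + Y 2 2.
  by rewrite /mxtrace !big_ord_recl big_ord0 !mxE /= addr0.
have ta : tautological ((rho r)%:C *: xi0 R) Z = (rho r)%:C * Y 0 1.
  rewrite /tautological mxE !big_ord_recl big_ord0 !mxE /=.
  by rewrite mulr1 mulr0 mul0r !addr0.
(* The radial part [e] pairs with [xi] to a real number and drops out of the imaginary part. *)
have ve : complex.Im (vertical ((rho r)%:C *: xi0 R) Z (e%:C *: xi0 R)) =
    - 2 * (r ^+ 4 - 1) * kappa Y.
  rewrite /vertical /liecoact trZ mxE !big_ord_recl big_ord0 !hadjE !mxE.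
  rewrite !big_ord_recl !big_ord0 !mxE /= -rho_sq // /kappa.
  rewrite !(mulr1, mulr0, mul0r, rmorph0, addr0).
  move: tY; case: (Y 0 0) (Y 1 1) (Y 2 2) => [? ?] [? ?] [? ?] /= ->.
  by field.
rewrite /model w2 trZ ta ve /zeta /nu.
have -> : complex.Im (Y 0 0 + Y 2 2) = - complex.Im (Y 1 1).
  by move: tY; case: (Y 0 0) (Y 2 2) => [? ?] [? ?] /= ->; ring.
have -> : complex.Re ((rho r)%:C * Y 0 1) = rho r * complex.Re (Y 0 1).
  by case: (Y 0 1) => ? ? /=; ring.
have -> : complex.Im ((rho r)%:C * Y 0 1) = rho r * complex.Im (Y 0 1).
  by case: (Y 0 1) => ? ? /=; ring.
rewrite intrN; have r2 : 1 + r ^+ 2 != 0.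
  by rewrite lt0r_neq0 // ltr_pwDl // sqr_ge0.
by rewrite /kappa; field; rewrite r0 r2.
Qed.

Lemma trivial_bundle_iso {R : realType} (k : int) :
  @bundle_iso R (- k) k (fun _ _ => 1).
Proof.
split=> *; [exact: normr1 | exact: smooth_near_cst | exact: smooth_near_cst |].
rewrite /chi det_isotropy // opprK mul1r exprz_inv -expfzDr ?subrr //.
by rewrite -normr_eq0 (_ : `|_| = 1) ?oner_eq0.
Qed.

(** The gauge [u = 1] has [darg = 0], so the pullback formula is the connection itself; these three
    parameters cover the regular members of all three families. *)
Lemma extends_of_model {R : realType} (k : int) (c0 c1 c2 : R) (p0 p1 p2 : R -> R) :
  (forall r, 1 < r ->
    [/\ p0 r = - ((- k)%:~R / r ^+ 2) + c0 * ((1 - r ^+ 4) / r ^+ 2),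
        p1 r = c1 * rho r & p2 r = c2 * rho r]) ->
  extends_to_Et (- k) k p0 p1 p2.
Proof.
move=> p; exists (model k c0 c1 c2), (fun _ _ => 1); split.
- exact: model_connection.
- exact: trivial_bundle_iso.
- move=> r h x Y r1 h3 Y3; have [p0E p1E p2E] := p r r1.
  rewrite model_pullback // /conn p0E p1E p2E /darg.
  by rewrite !derive_cst mulr0 mulr0 subr0 subr0.
Qed.

(** * Excluding the singular parameters *)

Lemma powR_half {R : realType} (r : R) : 1 < r ->
  (r ^+ 4 - 1) `^ (1 / 2) = rho r.
Proof.
by move=> r1; rewrite div1r powR12_sqrt // subr_ge0 exprn_ege1 // ltW.
Qed.

Lemma powR_m3half {R : realType} (r : R) : 1 < r ->
  (r ^+ 4 - 1) `^ (- (3 / 2)) = (rho r)^-1 ^+ 3.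
Proof.
move=> r1; rewrite powRN (_ : 3 / 2 = 1 / 2 * 3%:R); last by field.
by rewrite powRrM powR_half // powR_mulrn ?exprVn // ltW // rho_gt0.
Qed.

Lemma eq0_of_linear_bound {R : realType} (C M : R) :
  (forall s, 0 < s -> s <= 1 -> `|C| <= M * s) -> C = 0.
Proof.
move=> H; apply: contraTeq isT => C0; have C1 : 0 < `|C| by rewrite normr_gt0.
have M0 : 0 < M by have := H 1 ltr01 (lexx _); rewrite mulr1; exact: lt_le_trans.
have D0 : 0 < M + `|C| by rewrite addr_gt0.
(* This value of [s] turns the bound into [M + |C| <= M]. *)
have := H (`|C| / (M + `|C|)) (divr_gt0 C1 D0).
rewrite ler_pdivrMr // mul1r lerDr ltW // => /(_ isT).
by rewrite mulrCA ler_pMr // ler_pdivlMr // mul1r gerDl leNgt C1.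
Qed.

(** The local bound is used through one pair for each [s]: [r] solves [r^4 = 1 + s^2], and [r'] lies
    slightly below [r]. Letting [s] tend to 0 afterwards rules out poles. *)
Lemma lipschitz_pair {R : realType} {c : R -> R} {L : R} :
  (forall r, 1 < r -> rho r <= 1 ->
    \forall r' \near r, 1 < r' -> rho r' <= 1 ->
      `|c r - c r'| <= L * `|rho r - rho r'|) ->
  forall s, 0 < s -> s <= 1 -> exists r r', [/\ 1 < r, 1 < r', rho r = s,
    rho r' < s & `|c r - c r'| <= L * (s - rho r')].
Proof.
move=> H s s0 s1; pose r := Num.sqrt (Num.sqrt (1 + s ^+ 2)).
have s2 : 0 < s ^+ 2 by rewrite exprn_gt0.
have r1 : 1 < r by rewrite -[ltLHS]sqrtr1 ltr_sqrt -?[ltLHS]sqrtr1 ?ltr_sqrt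
  ?sqrtr_gt0 ?addr_gt0 // ltrDl.
have r4 : r ^+ 4 = 1 + s ^+ 2.
  by rewrite (exprM r 2 2) !sqr_sqrtr ?sqrtr_ge0 // addr_ge0 // ltW.
have rs : rho r = s by rewrite /rho r4 addrC addKr sqrtr_sqr gtr0_norm.
have : \forall r' \near r^'-, 1 < r' /\ r' < r /\
    (1 < r' -> rho r' <= 1 -> `|c r - c r'| <= L * `|rho r - rho r'|).
  near=> r'; split; [|split].
  - by near: r'; exact: nbhs_left_gt.
  - by near: r'; exact: nbhs_left_lt.
  - by near: r'; apply: cvg_within; apply: H; rewrite ?rs.
move=> /filter_ex[r' [r'1 [r'r Lr']]].
have lt : rho r' < s.
  rewrite -rs ltr_sqrt ?subr_gt0 ?exprn_egt1 // ltrD2r ltrXn2r ?nnegrE //;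
  by rewrite ltW // (lt_trans ltr01).
exists r, r'; split => //; rewrite -[s - _]gtr0_norm ?subr_gt0 // -rs.
by apply: Lr' => //; rewrite (le_trans (ltW lt)).
Unshelve. all: by end_near. Qed.

(** The gap equals [(s - s') / (s s')]. Keeping a single factor [1 / s] is enough, since any
    unbounded slope contradicts the Lipschitz bound. *)
Lemma inv_gap {R : realType} (s s' : R) : 0 < s' -> s' < s -> s <= 1 ->
  1 <= s^-1 /\ (s - s') / s <= s'^-1 - s^-1.
Proof.
move=> s'0 s's s1; have s0 := lt_trans s'0 s's.
have i1 : 1 <= s^-1 by rewrite invf_ge1.
split => //; have -> : s'^-1 - s^-1 = (s - s') / s * s'^-1.
  by field; rewrite !lt0r_neq0.
rewrite ler_peMr ?divr_ge0 ?subr_ge0 ?(ltW s0) ?(ltW s's) //.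
by rewrite invf_ge1 // (le_trans (ltW s's)).
Qed.

(** Inverses are at least 1, so cubing them only widens the gap of [inv_gap]; the Lipschitz bound
    then gives [|C| <= L s] for every small [s]. *)
Lemma inv_cube_coef_eq0 {R : realType} (c : R -> R) (C L : R) :
  (forall r, 1 < r -> rho r <= 1 ->
    \forall r' \near r, 1 < r' -> rho r' <= 1 ->
      `|c r - c r'| <= L * `|rho r - rho r'|) ->
  (forall r, 1 < r -> c r = C * (rho r)^-1 ^+ 3) -> C = 0.
Proof.
move=> H cE; apply: (@eq0_of_linear_bound _ _ L) => s s0 s1.
have [r [r' [r1 r'1 rs r's]]] := lipschitz_pair H s s0 s1.
rewrite !cE // rs; have := rho_gt0 _ r'1; move: (rho r') r's => s' s's s'0.
rewrite -mulrBr normrM distrC => Ls; have [i1 d] := inv_gap _ _ s'0 s's s1.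
have ds : 0 < s - s' by rewrite subr_gt0.
have d0 : 0 < s'^-1 - s^-1 by apply: lt_le_trans d; rewrite divr_gt0.
have cube : (s - s') / s <= `|s'^-1 ^+ 3 - s^-1 ^+ 3|.
  apply: (le_trans d); apply: (le_trans _ (ler_norm _)).
  move: (s'^-1) (s^-1) i1 d0 => i' i i1 d0.
  have -> : i' ^+ 3 - i ^+ 3 = (i' - i) * (i' ^+ 2 + i' * i + i ^+ 2) by ring.
  rewrite ler_peMr ?(ltW d0) //; nra.
have := le_trans (ler_wpM2l (normr_ge0 C) cube) Ls.
by rewrite mulrA ler_pdivrMr // mulrAC ler_pM2r.
Qed.

(** The summand [N / r^2] is Lipschitz in [rho] with constant [|N|], while the polar summand has
    slope at least [|N C| / (2 s)]; hence [|N C| <= 2 (L + |N|) s]. For [N = 0] nothing is said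
    about [C], so the conclusion concerns the product. *)
Lemma pole_coef_eq0 {R : realType} (c : R -> R) (N C L : R) :
  (forall r, 1 < r -> rho r <= 1 ->
    \forall r' \near r, 1 < r' -> rho r' <= 1 ->
      `|c r - c r'| <= L * `|rho r - rho r'|) ->
  (forall r, 1 < r -> c r = - (N / r ^+ 2) * (1 + C / (r ^+ 4 - 1))) ->
  N * C = 0.
Proof.
move=> H cE; apply: (@eq0_of_linear_bound _ _ (2 * (L + `|N|))) => s s0 s1.
have [r [r' [r1 r'1 rs r's]]] := lipschitz_pair H s s0 s1.
have := rho_gt0 _ r'1; rewrite !cE // -!rho_sq // rs.
have qs (t : R) : 1 < t -> 1 <= t ^+ 2 /\ (t ^+ 2) ^+ 2 = 1 + rho t ^+ 2.
  by move=> t1; rewrite rho_sq // exprn_ege1 ?(ltW t1) // -exprM addrC subrK.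
have [q1 q2] := qs r r1; have [q'1 q'2] := qs r' r'1; rewrite rs in q2.
move: (rho r') (r ^+ 2) (r' ^+ 2) r's q1 q2 q'1 q'2 => s' q q' s's q1 q2 q'1 q'2 s'0.
have q0 : 0 < q := lt_le_trans ltr01 q1.
have q'0 : 0 < q' := lt_le_trans ltr01 q'1.
have [i1 d] := inv_gap _ _ s'0 s's s1.
have ds : 0 < s - s' by rewrite subr_gt0.
have d0 : 0 < s'^-1 - s^-1 by apply: lt_le_trans d; rewrite divr_gt0.
(* From [q^2 - q'^2 = s^2 - s'^2] with [q + q' >= 2 >= s + s']; the bound [q' <= 2] produces the
   factor 2 in the constant. *)
have qq : q' < q by nra.
have q'2' : q' <= 2 by nra.
have gap : q - q' <= s - s' by nra.
have gapV : q'^-1 - q^-1 <= s - s'.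
  apply: le_trans gap; have -> : q'^-1 - q^-1 = (q - q') / (q * q').
    by field; rewrite !lt0r_neq0.
  by rewrite ler_pdivrMr ?mulr_gt0 // ler_peMr ?subr_ge0 ?(ltW qq) //; nra.
have gapV0 : 0 < q'^-1 - q^-1 by rewrite subr_gt0 ltf_pV2.
(* Replace [q] by the smaller [q'] in the second term, then take out [1 / q' >= 1 / 2]. *)
have pole : (s - s') / s / 2 <= s'^-1 ^+ 2 / q' - s^-1 ^+ 2 / q.
  have : s^-1 ^+ 2 / q <= s^-1 ^+ 2 / q'.
    by rewrite ler_wpM2l ?sqr_ge0 // lef_pV2 // ltW.
  have : (s - s') / s / 2 <= (s'^-1 ^+ 2 - s^-1 ^+ 2) / q'.
    have h2 : 2^-1 <= q'^-1 by rewrite lef_pV2 ?posrE.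
    apply: ler_pM => //; first by apply: divr_ge0; exact: ltW.
    apply: (le_trans d); move: (s'^-1) (s^-1) i1 d0 => i' i i1 d0; nra.
  rewrite mulrBl; lra.
set X := `|_ - _|; move=> Ls.
(* Separates the polar part of the difference of [c] from its Lipschitz part. *)
have E : `|N * C| * (s'^-1 ^+ 2 / q' - s^-1 ^+ 2 / q) <= X + `|N| * (q'^-1 - q^-1).
  have p0 : 0 <= s'^-1 ^+ 2 / q' - s^-1 ^+ 2 / q.
    by apply: le_trans pole; do 2 apply: divr_ge0 => //; exact: ltW.
  rewrite -[X in `|_| * X <= _]ger0_norm // -normrM.
  rewrite -[X in _ <= _ + `|_| * X]gtr0_norm // -normrM.
  rewrite (_ : N * C * _ =
    (- (N / q) * (1 + C / s ^+ 2) - - (N / q') * (1 + C / s' ^+ 2)) - N * (q'^-1 - q^-1)); first exact: ler_normB.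
  by field; rewrite !lt0r_neq0.
have := le_trans (ler_wpM2l (normr_ge0 (N * C)) pole) E.
have : `|N| * (q'^-1 - q^-1) <= `|N| * (s - s') by rewrite ler_wpM2l.
move=> h1 h2; have {}h2 : `|N * C| * ((s - s') / s / 2) <= (L + `|N|) * (s - s').
  by apply: (le_trans h2); rewrite mulrDl lerD.
have E' : `|N * C| * ((s - s') / s / 2) = `|N * C| / (2 * s) * (s - s').
  by field; rewrite lt0r_neq0.
move: h2; rewrite E' ler_pM2r // ler_pdivrMr ?mulr_gt0 //.
by rewrite mulrCA mulrA.
Qed.

(** The relation between [n] and [k] enters as extendability of the homogeneous bundle, which by
    [bundle_extendsP] means [n = - k]. For [n = 0] the function [p0] of the I- and K-families
    vanishes whatever [C0] is, so there [C0 = 0] is asserted for [n != 0]. *)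
Theorem theorem5p8 (R : realType) (n k : int) (hnk : bundle_extends R n k)
    (C0 C1 C2 : R) (p0 p1 p2 : R -> R) :
  [/\ spin7_instanton LI n p0 p1 p2 ->
      (forall r : R, 1 < r ->
        [/\ p0 r = - (n%:~R / r ^+ 2) * (1 + C0 / (r ^+ 4 - 1)),
            p1 r = C1 * (r ^+ 4 - 1) `^ (1 / 2)
          & p2 r = C2 * (r ^+ 4 - 1) `^ (- (3 / 2))]) ->
      (extends_to_Et n k p0 p1 p2 <-> (n != 0 -> C0 = 0) /\ C2 = 0),
      spin7_instanton LJ n p0 p1 p2 ->
      (forall r : R, 1 < r ->
        [/\ p0 r = - (n%:~R / r ^+ 2) + C0 * ((1 - r ^+ 4) / r ^+ 2),
            p1 r = C1 * (r ^+ 4 - 1) `^ (- (3 / 2))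
          & p2 r = C2 * (r ^+ 4 - 1) `^ (- (3 / 2))]) ->
      (extends_to_Et n k p0 p1 p2 <-> C1 = 0 /\ C2 = 0)
    & spin7_instanton LK n p0 p1 p2 ->
      (forall r : R, 1 < r ->
        [/\ p0 r = - (n%:~R / r ^+ 2) * (1 + C0 / (r ^+ 4 - 1)),
            p1 r = C1 * (r ^+ 4 - 1) `^ (- (3 / 2))
          & p2 r = C2 * (r ^+ 4 - 1) `^ (1 / 2)]) ->
      (extends_to_Et n k p0 p1 p2 <-> (n != 0 -> C0 = 0) /\ C1 = 0)].
Proof.
have [ext _] := bundle_extendsP R n k; have {ext}nk := ext hnk; rewrite {}nk.
(* The three coordinate circles isolate [p0], [p1] and [p2]. *)
have [u0 u1 u2] : [/\ 1 ^+ 2 + 0 ^+ 2 + 0 ^+ 2 = 1 :> R,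
    0 ^+ 2 + 1 ^+ 2 + 0 ^+ 2 = 1 :> R & 0 ^+ 2 + 0 ^+ 2 + 1 ^+ 2 = 1 :> R].
  by split; ring.
have pole C : (forall r, 1 < r ->
      p0 r = - ((- k)%:~R / r ^+ 2) * (1 + C / (r ^+ 4 - 1))) ->
    extends_to_Et (- k) k p0 p1 p2 -> - k != 0 -> C = 0.
  move=> p0E ext k0; have [L HL] := extends_locally_lipschitz 1 0 0 u0 ext.
  have /eqP : (- k)%:~R * C = 0 :> R.
    apply: pole_coef_eq0 HL _ => r r1.
    by rewrite p0E // mulr1 !mulr0 !addr0.
  by rewrite mulf_eq0 intr_eq0 (negPf k0) /= => /eqP.
have cube1 C : (forall r, 1 < r -> p1 r = C * (r ^+ 4 - 1) `^ (- (3 / 2))) ->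
    extends_to_Et (- k) k p0 p1 p2 -> C = 0.
  move=> p1E ext; have [L HL] := extends_locally_lipschitz 0 1 0 u1 ext.
  apply: inv_cube_coef_eq0 HL _ => r r1.
  by rewrite p1E // powR_m3half // mulr1 !mulr0 addr0 add0r.
have cube2 C : (forall r, 1 < r -> p2 r = C * (r ^+ 4 - 1) `^ (- (3 / 2))) ->
    extends_to_Et (- k) k p0 p1 p2 -> C = 0.
  move=> p2E ext; have [L HL] := extends_locally_lipschitz 0 0 1 u2 ext.
  apply: inv_cube_coef_eq0 HL _ => r r1.
  by rewrite p2E // powR_m3half // mulr1 !mulr0 !add0r.
(* Either [n = 0] and both sides vanish, or [C = 0] and the polar term is absent; in both cases the
   model has [c0 = 0]. *)
have p0_regular r C : (- k != 0 -> C = 0) ->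
    - ((- k)%:~R / r ^+ 2) * (1 + C / (r ^+ 4 - 1)) =
    - ((- k)%:~R / r ^+ 2) + 0 * ((1 - r ^+ 4) / r ^+ 2) :> R.
  have [-> _|_ /(_ isT) ->] := eqVneq (- k) 0.
    by rewrite !mul0r oppr0 mul0r addr0.
  by rewrite !mul0r !addr0 mulr1.
split=> _ p; split.
- move=> ext; split; first by apply: pole ext => r /p[].
  by apply: cube2 ext => r /p[].
- move=> [C0E C2E]; apply: (@extends_of_model _ _ 0 C1 0) => r r1.
  have [-> -> ->] := p r r1; rewrite powR_half // C2E.
  by split; [exact: p0_regular | | rewrite !mul0r].
- by move=> ext; split; [apply: cube1 ext | apply: cube2 ext] => r /p[].
- move=> [C1E C2E]; apply: (@extends_of_model _ _ C0 0 0) => r r1.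
  by have [-> -> ->] := p r r1; rewrite C1E C2E !mul0r.
- move=> ext; split; first by apply: pole ext => r /p[].
  by apply: cube1 ext => r /p[].
- move=> [C0E C1E]; apply: (@extends_of_model _ _ 0 0 C2) => r r1.
  have [-> -> ->] := p r r1; rewrite powR_half // C1E.
  by split; [exact: p0_regular | rewrite !mul0r |].
Qed.
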